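(* Let $V=GF(3)^4$ and let $\mathcal{D}$ be a $2$-$(3^{4},3^{2},3)$ design with point set $V$ admitting a flag-transitive automorphism group $G=TG_{0}$, where $T$ is the translation group of $V$ and $G_0\le GL_4(3)$ is contained in a subgroup of $GL_4(3)$ of the form $(R\circ SL_{2}(5)):Z_{2}$ with $R\cong D_{8}\circ Q_{8}$ (i.e. the normalizer in $GL_4(3)$ of such a subgroup $R$). Then $\mathcal{D}$ is isomorphic to the design $\mathcal{D}_3$ described in the context.
   Context: A $2$-$(v,k,\lambda)$ design has $v$ points and $k$-subsets (blocks), every two points in exactly $\lambda$ blocks; flag-transitive = transitive on incident point-block pairs. Matrices act on row vectors on the right. Let $\alpha\in GL_4(3)$ have rows $(0,0,0,-1)$, $(-1,0,1,1)$, $(-1,-1,0,-1)$, $(1,0,0,0)$, and $\beta$ have rows $(1,1,0,0)$, $(0,1,0,0)$, $(0,0,1,1)$, $(0,0,0,1)$; then $H_0=\langle\alpha,\beta\rangle\cong SL_2(5)$. Let $B_0=\langle(1,0,0,0),(0,0,0,1)\rangle_{GF(3)}$. $\mathcal{D}_3$ is the design with point set $V$ and blocks $\{vA+c: v\in B_0\}$, $A\in H_0$, $c\in V$. $D_8\circ Q_8$ denotes the central product (extraspecial group of order $32$ of minus type). *)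

(* Defs.v *)
From HB Require Import structures.
From mathcomp Require Import all_boot all_algebra all_fingroup all_solvable.

Set Implicit Arguments.
Unset Strict Implicit.
Unset Printing Implicit Defensive.

Import GRing.Theory.
Local Open Scope ring_scope.

(* A block is identified with its set of points: there are no repeated blocks. *)
Definition is_2design (T : finType) (v k lambda : nat) (D : {set {set T}}) : Prop :=
  [/\ #|T| = v,
      forall B, B \in D -> #|B| = k
    & forall x y : T, x != y -> #|[set B in D | (x \in B) && (y \in B)]| = lambda].

Definition design_iso (T1 T2 : finType)
    (D1 : {set {set T1}}) (D2 : {set {set T2}}) : Prop :=
  exists2 f : T1 -> T2, bijective f & [set f @: B | B : {set T1} in D1] = D2.

(* The setwise stabiliser of D under the action of permutations on {set T}. *)
Definition design_aut (T : finType) (D : {set {set T}}) : {set {perm T}} :=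
  'N(D | 'P^*)%g.

Definition flag_transitive (T : finType) (G : {set {perm T}})
    (D : {set {set T}}) : Prop :=
  forall (x y : T) (B C : {set T}),
    B \in D -> x \in B -> C \in D -> y \in C ->
    exists2 g : {perm T}, g \in G & g x = y /\ g @: B = C.

Local Notation V := 'rV['F_3]_4.

Definition translation (c : V) : {perm V} := perm (addIr c).

Definition translations : {set {perm V}} := [set translation c | c : V].

Definition linear_perm (g : {'GL_4(3)}) : {perm V} :=
  perm (can_inj (mulmxK (GL_unitmx g))).

Definition mx4 (s : seq (seq 'F_3)) : 'M['F_3]_4 :=
  \matrix_(i, j) nth 0 (nth [::] s i) j.

Definition alpha_mx : 'M['F_3]_4 :=
  mx4 [:: [::  0;  0;  0; -1];
          [:: -1;  0;  1;  1];
          [:: -1; -1;  0; -1];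
          [::  1;  0;  0;  0]].

Definition beta_mx : 'M['F_3]_4 :=
  mx4 [:: [:: 1; 1; 0; 0];
          [:: 0; 1; 0; 0];
          [:: 0; 0; 1; 1];
          [:: 0; 0; 0; 1]].

Fact alpha_unit : alpha_mx \is a GRing.unit.
Proof.
pose w := mx4 [:: [:: 0; 0; 0; 1]; [:: 1; 0; -1; -1];
                  [:: 1; 1; 0; 1]; [:: -1; 0; 0; 0]].
suff /mulmx1_unit [] : alpha_mx *m w = 1%:M by [].
apply/matrixP=> i j; rewrite !mxE !big_ord_recl big_ord0 !mxE /=.
by case: i j => [[|[|[|[|]]]] //= ?] [[|[|[|[|]]]] //= ?]; apply/val_inj.
Qed.

Fact beta_unit : beta_mx \is a GRing.unit.
Proof.
pose w := mx4 [:: [:: 1; -1; 0; 0]; [:: 0; 1; 0; 0];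
                  [:: 0; 0; 1; -1]; [:: 0; 0; 0; 1]].
suff /mulmx1_unit [] : beta_mx *m w = 1%:M by [].
apply/matrixP=> i j; rewrite !mxE !big_ord_recl big_ord0 !mxE /=.
by case: i j => [[|[|[|[|]]]] //= ?] [[|[|[|[|]]]] //= ?]; apply/val_inj.
Qed.

Definition alpha : {'GL_4(3)} := Sub alpha_mx alpha_unit.
Definition beta : {'GL_4(3)} := Sub beta_mx beta_unit.

Definition H0 : {set {'GL_4(3)}} := <<[set alpha; beta]>>%g.

Definition B0 : {set V} :=
  [set v : V | v \in <<[:: delta_mx 0%R 0%R; delta_mx 0%R ord_max]>>%VS].

Definition D3 : {set {set V}} :=
  [set [set v *m GLval A + c | v in B0] | A : {'GL_4(3)} in H0, c : V in [set: V]].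

(* Main.v *)
(*
R has exactly ten noncentral involutions, five up to sign, and any two that are not
opposite anticommute. An element f of order 5 in G0 permutes the five pairs cyclically, so a
suitable involution t yields anticommuting t, t^f, ..., t^(f^4) with product 1. These generate
a Clifford algebra with a unique 4-dimensional module, hence in a suitable basis they and f
are explicit matrices, and an element h of order 3 in G0 is one of 80 explicit matrices. (Both
exist because G0 is transitive on the 30 blocks through 0.)

Every nonempty <f, h>-invariant set of nonzero vectors has more than 20 elements, which forces
every block through 0 to be its own group of periods, hence a plane. These 30 planes form a
union of <f, h>-orbits that covers each nonzero vector three times; moreover either all of
them or none are stabilised by a noncentral involution of R, since G0 normalises R. An
enumeration of the 80 matrices leaves one possible set of planes of each kind, and an explicit
matrix maps it to the blocks of D3 through 0.
*)
Require Import Defs.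
From HB Require Import structures.
From mathcomp Require Import all_boot all_algebra all_fingroup all_solvable.
From mathcomp Require Import ring zify.

Set Implicit Arguments.
Unset Strict Implicit.
Unset Printing Implicit Defensive.

Import GRing.Theory.

(* GF(3) is coded by option bool, with None = 0, Some false = 1 and Some true = -1, so that
   the kernel can enumerate vectors (v4), matrices (m4) and planes (line: a pair of
   generators, seen as a line of the projective space). *)
Local Notation f3 := (option bool).
Local Notation v4 := (f3 * f3 * f3 * f3)%type.
Local Notation m4 := (v4 * v4 * v4 * v4)%type.
Local Notation line := (v4 * v4)%type.
Local Notation z3 := (None : f3).
Local Notation p3 := (Some false : f3).
Local Notation n3 := (Some true : f3).

(** * Explicit vectors, matrices and planes over GF(3) *)

(** [G0] need not contain [R]: all that is known of it is that it normalises [R] and is transitive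
    on the blocks through 0. The enumerations therefore use only the two elements that Cauchy's
    theorem supplies. The basis is adapted to [f] alone, so [h] has to be enumerated. It acts on the
    five pairs of involutions as one of the 20 three-cycles, and each three-cycle has 4 lifts of
    order 3 in the normaliser, conjugate under [R] because the centraliser of [h] in [R] has order
    8; this gives 80.

    An invariant set of planes is sought as a union of computed orbits. For this it suffices that
    every invariant predicate is constant on each list and that the lengths of the lists show them
    to be a partition. Separating planes by noncentral stabilisers shortens the list whose unions
    are formed and decides which of the two explicit matrices is applied. *)

Definition opp3 (a : f3) : f3 := omap negb a.

Definition add3 (a b : f3) : f3 :=
  match a, b with
  | None, _ => b
  | _, None => a
  | Some x, Some y => if x == y then Some (~~ x) else None
  end.

Definition vopp (u : v4) : v4 :=
  let: (a, b, c, d) := u in (opp3 a, opp3 b, opp3 c, opp3 d).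

Definition vadd (u w : v4) : v4 :=
  let: (a, b, c, d) := u in let: (a', b', c', d') := w in
  (add3 a a', add3 b b', add3 c c', add3 d d').

Definition vzero : v4 := (z3, z3, z3, z3).

Definition vscale (a : f3) (u : v4) : v4 :=
  match a with None => vzero | Some false => u | Some true => vopp u end.

Definition vmul (u : v4) (m : m4) : v4 :=
  let: (a, b, c, d) := u in let: (r0, r1, r2, r3) := m in
  vadd (vadd (vadd (vscale a r0) (vscale b r1)) (vscale c r2)) (vscale d r3).

Definition mmul (x y : m4) : m4 :=
  let: (r0, r1, r2, r3) := x in (vmul r0 y, vmul r1 y, vmul r2 y, vmul r3 y).

Definition mopp (x : m4) : m4 :=
  let: (r0, r1, r2, r3) := x in (vopp r0, vopp r1, vopp r2, vopp r3).

Definition mone : m4 :=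
  ((p3, z3, z3, z3), (z3, p3, z3, z3), (z3, z3, p3, z3), (z3, z3, z3, p3)).

Definition vectors : seq v4 :=
  let s := [:: z3; p3; n3] in
  [seq (x, d) | x <- [seq (x, c) | x <- [seq (a, b) | a <- s, b <- s],
                       c <- s], d <- s].

Definition nonzero_vectors : seq v4 := behead vectors.

(** There are always nine entries, with repetitions exactly when the generators are dependent;
    [uniq (pts l)] thus expresses that [l] is a plane. *)
Definition pts (l : line) : seq v4 :=
  [seq vadd (vscale a l.1) (vscale b l.2) | a <- [:: z3; p3; n3], b <- [:: z3; p3; n3]].

Section Orbits.
Variables (A : eqType) (acts : seq (A -> A)).

Definition push (ts : seq A * seq A) (y : A) : seq A * seq A :=
  if y \in ts.2 then ts else (y :: ts.1, y :: ts.2).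

Fixpoint closure (fuel : nat) (todo seen : seq A) : seq A :=
  match fuel, todo with
  | S k, x :: t =>
      let: (t', seen') := foldl push (t, seen) [seq a x | a <- acts] in
      closure k t' seen'
  | _, _ => seen
  end.

(* The fuel only has to be large enough for the checks below to succeed. *)
Definition reach (x : A) : seq A := closure 200 [:: x] [:: x].

Fixpoint orbits (os : seq (seq A)) (s : seq A) : seq (seq A) :=
  match s with
  | [::] => os
  | x :: s' => orbits (if has (fun o => x \in o) os then os else reach x :: os) s'
  end.

(* All unions of members of os of size n, plus smaller ones. *)
Fixpoint unions (os : seq (seq A)) (n : nat) : seq (seq A) :=
  match os with
  | [::] => [:: [::]]
  | o :: os' =>
      (if size o <= n then [seq o ++ x | x <- unions os' (n - size o)] else [::])
        ++ unions os' n
  end.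

End Orbits.

Definition coords (u : v4) : seq f3 := let: (a, b, c, d) := u in [:: a; b; c; d].
Definition lead (u : v4) : nat := find isSome (coords u).
Definition coord (u : v4) (i : nat) : f3 := nth z3 (coords u) i.
Definition monic (u : v4) : v4 := vscale (coord u (lead u)) u.

Definition rref (l : line) : line :=
  let u := monic l.1 in let w := monic l.2 in
  let w := if lead u == lead w then monic (vadd w (vopp u)) else w in
  let: (u, w) := if lead u <= lead w then (u, w) else (w, u) in
  (vadd u (vopp (vscale (coord u (lead w)) w)), w).

(* The two-way membership test makes canon span-preserving by construction, so that rref
   needs no correctness proof. *)
Definition canon (l : line) : line :=
  let r := rref l in
  if [&& l.1 \in pts r, l.2 \in pts r, r.1 \in pts l & r.2 \in pts l] then r else l.

Definition lact (m : m4) (l : line) : line := canon (vmul l.1 m, vmul l.2 m).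

Definition lines : seq line := Eval vm_compute in
  [seq l <- [seq (u, w) | u <- vectors, w <- vectors] |
     (rref l == l) && uniq (pts l)].

(* The matrices of anticommuting involutions t0, ..., t3 in the basis v, v t1 t2, v t1, v t2,
   where v t0 = v and v t1 t3 = v + v t1 t2. *)
Definition T0 : m4 :=
  ((p3, z3, z3, z3), (z3, p3, z3, z3), (z3, z3, n3, z3), (z3, z3, z3, n3)).
Definition T1 : m4 :=
  ((z3, z3, p3, z3), (z3, z3, z3, n3), (p3, z3, z3, z3), (z3, n3, z3, z3)).
Definition T2 : m4 :=
  ((z3, z3, z3, p3), (z3, z3, p3, z3), (z3, p3, z3, z3), (p3, z3, z3, z3)).
Definition T3 : m4 :=
  ((z3, z3, n3, p3), (z3, z3, n3, n3), (p3, p3, z3, z3), (n3, p3, z3, z3)).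
Definition T4 : m4 := Eval vm_compute in mmul (mmul T0 T1) (mmul T2 T3).
Definition clifford := [:: T0; T1; T2; T3; T4].
Definition signed_clifford := clifford ++ [seq mopp t | t <- clifford].

(* A matrix X with T_i X = X a_i is determined by its first row p, which satisfies the two
   equations that characterise the first basis vector. *)
Definition framed (p : v4) (a0 a1 a2 a3 : m4) : bool :=
  let q := vmul p a1 in
  (vmul p a0 == p) && (vmul q a3 == vadd p (vmul q a2)).

Definition frame (p : v4) (a1 a2 : m4) : m4 :=
  let q := vmul p a1 in (p, vmul q a2, q, vmul p a2).

(* The element of order 5 with T_i f0 = f0 T_(i+1); the other candidates are 0 and - f0. *)
Definition f0 : m4 := Eval vm_compute in
  nth mone [seq frame p T2 T3 | p <- vectors & framed p T1 T2 T3 T4] 2.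

Definition anti (x y : m4) : bool := mmul x y == mopp (mmul y x).

Definition cube (h : m4) := mmul h (mmul h h).

(* The elements of order 3 that permute the signed T_i under conjugation. *)
Definition order3 : seq m4 :=
  [seq h <- flatten [seq flatten [seq flatten [seq flatten [seq
    [seq frame p a1 a2 | p <- vectors & framed p a0 a1 a2 a3]
    | a3 <- signed_clifford & [&& anti a0 a3, anti a1 a3 & anti a2 a3]]
    | a2 <- signed_clifford & anti a0 a2 && anti a1 a2]
    | a1 <- signed_clifford & anti a0 a1]
    | a0 <- signed_clifford]
  | (cube h == mone) && (h != mone)].

Definition stabilised (l : line) : bool :=
  has (fun t => (vmul l.1 t \in pts l) && (vmul l.2 t \in pts l)) signed_clifford.

Definition design (X : seq line) : bool :=
  all (fun p => count (fun l => p \in pts l) X == 3) nonzero_vectors.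

(* Found by search: one matrix for each of the two possible sets of planes. *)
Definition toD3 (b : bool) : m4 :=
  if b then ((p3, z3, z3, z3), (p3, n3, p3, z3), (z3, z3, n3, z3), (p3, z3, p3, n3))
  else ((z3, n3, z3, z3), (p3, p3, z3, n3), (p3, n3, n3, p3), (p3, p3, n3, n3)).

Definition alpha4 : m4 :=
  ((z3, z3, z3, n3), (n3, z3, p3, p3), (n3, n3, z3, n3), (p3, z3, z3, z3)).
Definition beta4 : m4 :=
  ((p3, p3, z3, z3), (z3, p3, z3, z3), (z3, z3, p3, p3), (z3, z3, z3, p3)).
Definition base4 : line := ((p3, z3, z3, z3), (z3, z3, z3, p3)).
Definition base_lines : seq line := Eval vm_compute in
  reach [:: lact alpha4; lact beta4] base4.

Definition check_lines (h : m4) (b : bool) (s : seq line) : bool :=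
  let os := orbits [:: lact f0; lact h] [::] s in
  (size (flatten os) == size s) &&
  all (fun X => (size X == 30) && design X ==>
    all (fun l => lact (toD3 b) l \in base_lines) X) (unions os 30).

Definition check_vectors (h : m4) : bool :=
  let os := orbits [:: vmul^~ f0; vmul^~ h] [::] nonzero_vectors in
  (size (flatten os) == 80) && all (fun o => 20 < size o) os.

(** * Orbits and decoding *)

Section OrbitsTheory.
Variables (A : eqType) (a1 a2 : A -> A) (Q : pred A).
Hypotheses (Q1 : forall x, Q (a1 x) = Q x) (Q2 : forall x, Q (a2 x) = Q x).
Let acts := [:: a1; a2].

Lemma closure_sub fuel todo seen :
  {subset seen <= closure acts fuel todo seen}.
Proof.
elim: fuel todo seen => [|k IH] [|x t] seen //= y sy.
rewrite /push /=; do 2 case: ifP => _ /=; apply: IH; by rewrite ?inE sy ?orbT.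
Qed.

Lemma closure_invariant b fuel todo seen :
    {in todo, forall y, Q y = b} -> {in seen, forall y, Q y = b} ->
  {in closure acts fuel todo seen, forall y, Q y = b}.
Proof.
elim: fuel todo seen => [|k IH] [|x t] seen //= Ht Hs.
have Hx : Q x = b by apply: Ht; rewrite mem_head.
have Ht' : {in t, forall y, Q y = b} by move=> y ty; apply: Ht; rewrite inE ty orbT.
by rewrite /push /=; do 2 case: ifP => _ /=; apply: IH => y;
  do ?[case/predU1P => [->|]]; rewrite ?Q1 ?Q2; auto.
Qed.

Lemma reach_self x : x \in reach acts x.
Proof. by apply: closure_sub; rewrite mem_head. Qed.

Lemma reach_invariant x : {in reach acts x, forall y, Q y = Q x}.
Proof. by apply: closure_invariant => y; rewrite inE => /eqP ->. Qed.

Definition homogeneous (o : seq A) := exists b, {in o, forall y, Q y = b}.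

Lemma orbits_homogeneous os s :
  {in os, forall o, homogeneous o} -> {in orbits acts os s, forall o, homogeneous o}.
Proof.
elim: s os => [|x s IH] os Hos //=; apply: IH; case: ifP => // _ o.
by rewrite inE => /orP[/eqP ->|]; [exists (Q x); apply: reach_invariant | apply: Hos].
Qed.

Lemma orbits_sub os s :
  {subset flatten os <= flatten (orbits acts os s)}
  /\ {subset s <= flatten (orbits acts os s)}.
Proof.
elim: s os => [|x s IH] os /=; first by split.
have [H1 H2] := IH (if has (fun o => x \in o) os then os else reach acts x :: os).
split=> [y oy|y].
  by apply: H1; case: ifP => // _; rewrite /= mem_cat oy orbT.
rewrite inE => /orP[/eqP ->|]; last exact: H2.
apply: H1; case: ifP => [/hasP[o oos xo]|_]; first by apply/flattenP; exists o.
by rewrite /= mem_cat reach_self.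
Qed.

Lemma filter_homogeneous (o : seq A) : homogeneous o -> filter Q o = o \/ filter Q o = [::].
Proof.
case=> -[] H; [left; apply/all_filterP/allP => y /H -> //|right].
by apply/eqP; rewrite -(negbK (_ == _)) -has_filter; apply/hasPn => y /H ->.
Qed.

Lemma filter_unions os :
  {in os, forall o, homogeneous o} ->
  filter Q (flatten os) \in unions os (size (filter Q (flatten os))).
Proof.
elim: os => [//|o os IH] Hos /=.
have {}IH := IH (fun o' oos => Hos o' (mem_behead (s := o :: os) oos)).
rewrite filter_cat mem_cat; case: (filter_homogeneous (Hos o (mem_head _ _))) => ->.
  rewrite size_cat leq_addr addKn; apply/orP; left.
  by apply/mapP; exists (filter Q (flatten os)).
by rewrite IH orbT.
Qed.

(** The lists always cover [s]; equality of lengths then excludes overlaps and foreign elements, so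
    they partition [s]. As [Q] is constant on each of them, its solutions in [s] form one of the
    enumerated unions, up to order. *)
Lemma orbits_solution s :
    uniq s -> size (flatten (orbits acts [::] s)) = size s ->
  exists2 X, X \in unions (orbits acts [::] s) (count Q s) & perm_eq X (filter Q s).
Proof.
move=> us sz; have [_ ss] := orbits_sub [::] s.
have pe : perm_eq s (flatten (orbits acts [::] s)).
  have [_ e] := uniq_min_size us ss (eq_leq sz).
  by apply: uniq_perm => //; apply: leq_size_uniq us ss (eq_leq sz).
have pQ : perm_eq (filter Q (flatten (orbits acts [::] s))) (filter Q s).
  by rewrite perm_sym; apply: perm_filter.
exists (filter Q (flatten (orbits acts [::] s))) => //.
by rewrite -size_filter -(perm_size pQ); apply/filter_unions/orbits_homogeneous.
Qed.
End OrbitsTheory.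

Local Open Scope ring_scope.
Local Notation V := 'rV['F_3]_4.

Definition toF (a : f3) : 'F_3 :=
  match a with None => 0 | Some false => 1 | Some true => -1 end.
Definition toV (u : v4) : V := \row_j toF (nth z3 (coords u) j).
Definition rows (m : m4) : seq v4 := let: (a, b, c, d) := m in [:: a; b; c; d].
Definition toM (m : m4) : 'M['F_3]_4 := \matrix_(i, j) toV (nth vzero (rows m) i) 0 j.

Definition ofF (x : 'F_3) : f3 := if x == 0 then z3 else if x == 1 then p3 else n3.
Definition ofV (x : V) : v4 :=
  (ofF (x 0 0), ofF (x 0 1), ofF (x 0 2%:R), ofF (x 0 3%:R)).

Lemma toF_opp a : toF (opp3 a) = - toF a.
Proof. by case: a => [[]|]; rewrite /= ?opprK ?oppr0. Qed.
Lemma toF_add a b : toF (add3 a b) = toF a + toF b.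
Proof. by case: a b => [[]|] [[]|]; apply/val_inj. Qed.
Lemma ofFK : cancel ofF toF.
Proof. by move=> x; apply/val_inj; case: x => [[|[|[|]]]]. Qed.
Lemma toFK : cancel toF ofF.
Proof. by case=> [[]|]. Qed.

Lemma ord4P (P : 'I_4 -> Prop) : P 0 -> P 1 -> P 2%:R -> P 3%:R -> forall i, P i.
Proof.
move=> P0 P1 P2 P3 i.
have: i \in [:: 0; 1; 2%:R; 3%:R] by case: i => [[|[|[|[|]]]]].
by rewrite !inE => /or4P[] /eqP ->.
Qed.

Lemma ofVK : cancel ofV toV.
Proof. by move=> x; apply/rowP; apply: ord4P; rewrite mxE /= ofFK. Qed.

Lemma toVK : cancel toV ofV.
Proof. by case=> [[[a b] c] d]; rewrite /ofV !mxE /= !toFK. Qed.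
Definition toV_inj := can_inj toVK.

Lemma toV0 : toV vzero = 0.
Proof. by apply/rowP; apply: ord4P; rewrite !mxE. Qed.
Lemma toV_opp u : toV (vopp u) = - toV u.
Proof.
by case: u => [[[a b] c] d]; apply/rowP; apply: ord4P; rewrite !mxE /= toF_opp.
Qed.
Lemma toV_add u w : toV (vadd u w) = toV u + toV w.
Proof.
case: u w => [[[a b] c] d] [[[a' b'] c'] d'].
by apply/rowP; apply: ord4P; rewrite !mxE /= toF_add.
Qed.
Lemma toV_scale a u : toV (vscale a u) = toF a *: toV u.
Proof. by case: a => [[]|]; rewrite /= ?toV_opp ?toV0 ?scaleN1r ?scale1r ?scale0r. Qed.
Lemma toV_mul u m : toV (vmul u m) = toV u *m toM m.
Proof.
case: u m => [[[a b] c] d] [[[r0 r1] r2] r3].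
rewrite /vmul !toV_add !toV_scale; apply/rowP => j.
by rewrite !mxE !big_ord_recl big_ord0 !mxE /= addr0 !addrA.
Qed.
Lemma row_toM m i : row i (toM m) = toV (nth vzero (rows m) i).
Proof. by apply/rowP=> j; rewrite !mxE. Qed.
Lemma toM_mul x y : toM (mmul x y) = toM x *m toM y.
Proof.
apply/row_matrixP => i; rewrite row_mul !row_toM -toV_mul.
by case: x => [[[a b] c] d]; elim/ord4P: i.
Qed.
Lemma toM_opp x : toM (mopp x) = - toM x.
Proof.
apply/row_matrixP => i; rewrite linearN /= !row_toM -toV_opp.
by case: x => [[[a b] c] d]; elim/ord4P: i.
Qed.
Lemma toM_inj : injective toM.
Proof.
move=> [[[a b] c] d] [[[a' b'] c'] d'] /row_matrixP E.
have E' i := etrans (esym (row_toM _ i)) (etrans (E i) (row_toM _ i)).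
by move: (toV_inj (E' 0)) (toV_inj (E' 1)) (toV_inj (E' 2%:R)) (toV_inj (E' 3%:R))
  => /= -> -> -> ->.
Qed.
Lemma toM1 : toM mone = 1%:M.
Proof. by apply/matrixP; apply: ord4P; apply: ord4P; rewrite !mxE. Qed.

Lemma mem_vectors u : u \in vectors.
Proof. by case: u => [[[[[]|] [[]|]] [[]|]] [[]|]]. Qed.
Lemma uniq_vectors : uniq vectors. Proof. by []. Qed.
Lemma mem_nonzero u : (u \in nonzero_vectors) = (u != vzero).
Proof.
apply/idP/idP => [|nz]; first by apply: contraL => /eqP ->.
by have := mem_vectors u; rewrite (_ : vectors = vzero :: nonzero_vectors) // inE (negPf nz).
Qed.

Definition img (g : 'M['F_3]_4) (B : {set V}) : {set V} := [set v *m g | v in B].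

(** The rows of [M] serve as a basis, in which [u] is a coordinate vector. *)
Definition dec (M : 'M['F_3]_4) (u : v4) : V := toV u *m M.

(* Locked: otherwise unification unfolds it to a finite set of matrices. *)
HB.lock Definition lset (M : 'M['F_3]_4) (l : line) : {set V} :=
  [set x | x \in map (dec M) (pts l)].

Section Decode.
Variable M : 'M['F_3]_4.
Hypothesis uM : M \in unitmx.

Local Notation dec := (dec M).
Local Notation lset := (lset M).

Lemma dec_inj : injective dec.
Proof. by move=> u w /(can_inj (mulmxK uM))/toV_inj. Qed.
Lemma dec0 : dec vzero = 0. Proof. by rewrite /dec toV0 mul0mx. Qed.
Lemma dec_add u w : dec (vadd u w) = dec u + dec w.
Proof. by rewrite /dec toV_add mulmxDl. Qed.
Lemma dec_opp u : dec (vopp u) = - dec u.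
Proof. by rewrite /dec toV_opp mulNmx. Qed.
Lemma dec_scale a u : dec (vscale a u) = toF a *: dec u.
Proof. by rewrite /dec toV_scale scalemxAl. Qed.
Lemma dec_onto x : exists u, x = dec u.
Proof. by exists (ofV (x *m invmx M)); rewrite /dec ofVK mulmxKV. Qed.
Lemma dec_mul u m g : M *m g = toM m *m M -> dec (vmul u m) = dec u *m g.
Proof. by move=> E; rewrite /dec toV_mul -!mulmxA E. Qed.

Lemma in_lset l u : (dec u \in lset l) = (u \in pts l).
Proof. by rewrite lset.unlock inE mem_map //; apply: dec_inj. Qed.

Lemma lsetP l x :
  reflect (exists a b : 'F_3, x = a *: dec l.1 + b *: dec l.2) (x \in lset l).
Proof.
rewrite lset.unlock inE; apply: (iffP mapP) => [[_ /allpairsP[[a b] [_ _ ->]] ->]|[a [b ->]]].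
  by exists (toF a), (toF b); rewrite dec_add !dec_scale.
exists (vadd (vscale (ofF a) l.1) (vscale (ofF b) l.2)); last first.
  by rewrite dec_add !dec_scale !ofFK.
by apply/allpairsP; exists (ofF a, ofF b); split; rewrite //= ?inE;
  [case: (ofF a) => [[]|] | case: (ofF b) => [[]|]].
Qed.
Lemma card_lset l : uniq (pts l) = (#|lset l| == 9%N).
Proof.
rewrite lset.unlock cardsE -(map_inj_uniq dec_inj).
by apply/card_uniqP/eqP; rewrite size_map size_allpairs.
Qed.

End Decode.

(** Completeness of [lines]: the first alternative is linear dependence of [w] on [u], and every
    independent pair normalises to a listed plane. *)
Lemma lines_canon : all (fun u => all (fun w => (w \in [:: vzero; u; vopp u]) ||
  (uniq (pts (u, w)) && (canon (u, w) \in lines))) vectors) nonzero_vectors.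
Proof. by vm_compute. Qed.
Lemma lines_separated :
  all (fun l => all (fun l' => (l.1 \in pts l') && (l.2 \in pts l') ==> (l == l')) lines) lines.
Proof. by vm_compute. Qed.

Lemma combinationE (K : fieldType) (W : lmodType K) (x y : W) (i j a b c d : K) :
  i *: (a *: x + b *: y) + j *: (c *: x + d *: y)
  = (i * a + j * c) *: x + (i * b + j * d) *: y.
Proof. by rewrite !scalerDr !scalerA addrACA -!scalerDl. Qed.

Section Lines.
Variable M : 'M['F_3]_4.
Hypothesis uM : M \in unitmx.
Local Notation dec := (dec M).
Local Notation lset := (lset M).

Lemma lset_sub l r : dec l.1 \in lset r -> dec l.2 \in lset r -> lset l \subset lset r.
Proof.
move=> /lsetP[a [b Eu]] /lsetP[c [d Ew]]; apply/subsetP => x /lsetP[i [j ->]].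
apply/lsetP; exists (i * a + j * c), (i * b + j * d).
by rewrite Eu Ew combinationE.
Qed.

Lemma canon_lset l : lset (canon l) = lset l.
Proof.
rewrite /canon; move: (rref l) => r; case: ifP; last by [].
move=> /and4P[u_r w_r u_l w_l]; apply/eqP; rewrite eqEsubset; apply/andP.
by split; apply: lset_sub; rewrite (in_lset uM).
Qed.

Lemma lset_img m g l : M *m g = toM m *m M ->
  img g (lset l) = lset (vmul l.1 m, vmul l.2 m).
Proof.
move=> E; apply/setP => x; apply/imsetP/lsetP => /= [[y /lsetP[a [b ->]] ->]|[a [b ->]]].
  by exists a, b; rewrite !(dec_mul _ E) mulmxDl -!scalemxAl.
exists (a *: dec l.1 + b *: dec l.2); first by apply/lsetP; exists a, b.
by rewrite !(dec_mul _ E) mulmxDl -!scalemxAl.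
Qed.

Lemma img_lact m g l : M *m g = toM m *m M -> img g (lset l) = lset (lact m l).
Proof. by move=> E; rewrite /lact canon_lset (lset_img l E). Qed.

Lemma lset_lines_inj : {in lines &, injective lset}.
Proof.
move=> l l' Ll Ll' E; have /allP/(_ _ Ll')/implyP H := allP lines_separated l Ll.
apply/eqP/H; rewrite -!(in_lset uM) -E.
by apply/andP; split; apply/lsetP; [exists 1, 0 | exists 0, 1];
  rewrite scale1r scale0r ?addr0 ?add0r.
Qed.

(** Additive closure suffices over GF(3), where the only scalars are 0, 1 and -1 and [- y = y + y].
    Nine elements leave room for some [y] outside the line of [x], and the nine combinations of [x]
    and [y] then fill [B]. *)
Lemma subspace_lset (B : {set V}) :
    #|B| = 9%N -> 0 \in B -> {in B &, forall x y, x + y \in B} ->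
  exists2 l, l \in lines & B = lset l.
Proof.
move=> B9 B0 BD.
have [x Bx nx] : exists2 x, x \in B & x != 0.
  have /card_gt1P[x [y [Bx By nxy]]] : (1 < #|B|)%N by rewrite B9.
  by case: (eqVneq x 0) nxy => [-> n0y|nx _]; [exists y; rewrite // eq_sym | exists x].
have BN y : y \in B -> - y \in B.
  by move=> By; rewrite (_ : - y = y + y) ?BD //; apply/rowP=> j; rewrite !mxE;
    case: (y 0 j) => [[|[|[|]]] i] //; apply/val_inj.
have [y By ny] : exists2 y, y \in B & y \notin [:: 0%R; x; -x].
  have : (0 < #|B :\: [set y in [:: 0%R; x; -x]]|)%N.
    rewrite cardsD subn_gt0 B9 (@leq_ltn_trans #|[set y in [:: 0%R; x; -x]]|) //.
      by rewrite subset_leq_card // subsetIr.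
    by rewrite cardsE (leq_ltn_trans (card_size _)).
  by case/card_gt0P => y /setDP[By ny]; exists y => //; rewrite inE in ny.
have [[u Eu] [w Ew]] := (dec_onto uM x, dec_onto uM y).
have nu : u \in nonzero_vectors.
  by rewrite mem_nonzero; apply: contraNneq nx => u0; rewrite Eu u0 dec0.
have /allP/(_ _ (mem_vectors w))/orP[] := allP lines_canon u nu.
  move=> H; case/negP: ny; rewrite Eu Ew -(dec0 M) -dec_opp.
  by rewrite -[[:: _; _; _]]/(map dec [:: vzero; u; vopp u]) map_f.
case/andP => uuw Luw; exists (canon (u, w)); rewrite ?canon_lset //.
have BZ a z : z \in B -> a *: z \in B.
  rewrite -(ofFK a); case: (ofF a) => [[]|] Bz /=;
  by rewrite ?scaleN1r ?scale1r ?scale0r ?BN.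
apply/esym/eqP; rewrite eqEcard (eqP (etrans (esym (card_lset uM (u, w))) uuw)) B9 andbT.
by apply/subsetP => z /lsetP[a [b ->]] /=; rewrite -Eu -Ew BD ?BZ.
Qed.
End Lines.

(** * Generators of the central product of D8 and Q8 *)

Local Close Scope ring_scope.
Local Open Scope group_scope.

(** The element [z] stands for -1: the members of [t] are pairwise anticommuting involutions, before
    any matrix is considered. *)
Definition clifford_rel (gT : finGroupType) (z : gT) (t : seq gT) :=
  [/\ z != 1, z * z = 1, {in t, forall x, x * x = 1 /\ x * z = z * x}
    & pairwise (fun x y => x * y == z * (y * x)) t].

(** The equality of the two centres is what later identifies the square of the rotation in the
    dihedral factor with the squares in the quaternion factor. *)
Lemma DnQ1_cprod (gT : finGroupType) (R : {group gT}) : R \isog 'D^1*Q ->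
  exists H K : {group gT},
    [/\ H \isog 'D_8, K \isog 'Q_8, H * K = R, K \subset 'C(H) & 'Z(H) = 'Z(K)].
Proof.
case: (DnQ_P 1) => gz isoZ; rewrite isog_sym => /isogP[f injf defR].
have [iH iK] := (injm_cpairg1 isoZ, injm_cpair1g isoZ).
exists (f @* (cpairg1 isoZ @* 'D^1))%G, (f @* (cpair1g isoZ @* 'Q_8))%G; split=> /=.
- rewrite isog_sym (isog_trans _ (sub_isog _ injf)) ?subsetT //.
  rewrite (isog_trans _ (sub_isog _ iH)) ?subsetT // isog_sym.
  exact: isog_trans (pX1p2id 2) isog_2X1p2.
- by rewrite isog_sym (isog_trans _ (sub_isog _ injf)) ?subsetT // sub_isog.
- by rewrite -morphimMl ?subsetT // im_cpair.
- by rewrite morphim_cents ?im_cpair_cent.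
- by rewrite -2?(injm_center injf) ?subsetT // cpair_center_id.
Qed.

(** Here [x], [y] come from the dihedral factor and [u], [v] from the quaternion factor. The
    elements [u] and [v] have order 4, but multiplying them by the commuting [x] gives involutions,
    since [x * x * (u * u) = z * z = 1]. *)
Lemma clifford_rel_xyuv (gT : finGroupType) (x y u v z : gT) :
    z != 1 -> x * x = z -> u * u = z -> v * v = z -> y * y = 1 -> z * z = 1 ->
    y * x = z * (x * y) -> v * u = z * (u * v) ->
    u * x = x * u -> v * x = x * v -> u * y = y * u -> v * y = y * v ->
  clifford_rel z [:: y; x * y; x * u; x * v].
Proof.
move=> z1 xx uu vv yy zz yx vu ux vx uy vy.
have xz : x * z = z * x by rewrite -xx mulgA.
have uz : u * z = z * u by rewrite -uu mulgA.
have vz : v * z = z * v by rewrite -vv mulgA.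
have yz : y * z = z * y by rewrite -uu !mulgA -uy -!mulgA uy.
have tail (a b c w : gT) : a * b = c -> a * (b * w) = c * w by move=> <-; rewrite mulgA.
have xxA w := tail _ _ _ w xx; have uuA w := tail _ _ _ w uu.
have vvA w := tail _ _ _ w vv; have yyA w := tail _ _ _ w yy.
have zzA w := tail _ _ _ w zz; have yxA w := tail _ _ _ w yx.
have vuA w := tail _ _ _ w vu; have uxA w := tail _ _ _ w ux.
have vxA w := tail _ _ _ w vx; have uyA w := tail _ _ _ w uy.
have vyA w := tail _ _ _ w vy; have xzA w := tail _ _ _ w xz.
have uzA w := tail _ _ _ w uz; have vzA w := tail _ _ _ w vz.
have yzA w := tail _ _ _ w yz.
have assoc (a b c : gT) : a * b * c = a * (b * c) by rewrite mulgA.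
(* The rules bring every word to the order [z], [x], [y], [u], [v]. Each occurs twice, alone and
   followed by a word [w], because products are kept associated to the right. *)
pose norm := (assoc, @mul1g gT, @mulg1 gT, zzA, xzA, yzA, uzA, vzA, xxA, yyA, uuA, vvA, yxA, vuA, uxA, vxA,
  uyA, vyA, zz, xz, yz, uz, vz, xx, yy, uu, vv, yx, vu, ux, vx, uy, vy).
split=> //.
  by move=> t; rewrite !inE => /or4P[] /eqP ->; rewrite !norm.
by rewrite /= !andbT; do ?[apply/andP; split]; apply/eqP; rewrite !norm.
Qed.

Lemma DnQ1_generators (gT : finGroupType) (R : {group gT}) : R \isog 'D^1*Q ->
  exists z t0 t1 t2 t3 : gT, clifford_rel z [:: t0; t1; t2; t3] /\
    R :=: <<[set t0; t1; t2; t3]>>.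
Proof.
case/DnQ1_cprod=> H [K [isoH isoK defR cHK eZ]].
have [[x y] genH [oy xy]] := @generators_2dihedral _ H 3 isT isoH.
have [[u v] genK [ov vu uv]] := @generators_quaternion _ K 3 isT isoK.
have [[sdH _ _] _ _ _ [ZH _ _ _ _]] := dihedral2_structure (n := 3) isT genH isoH.
have [[ppK _ _] _ [ZK _ _ _ _] _ _] := quaternion_structure (n := 3) isT genK isoK.
have [_ Hx ox /setDP[Hy _]] := genH; have [_ Ku ou /setDP[Kv _]] := genK.
rewrite /= in ZH ZK vu ox ou.
have ox2 : #[x ^+ 2] = 2 by rewrite orderXdiv ox.
have ou2 : #[u ^+ 2] = 2 by rewrite orderXdiv ou.
have xu2 : x ^+ 2 = u ^+ 2.
  have : x ^+ 2 \in <[u ^+ 2]> by rewrite -[2%N]/(2 ^ 3.-2)%N -ZK -eZ ZH cycle_id.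
  rewrite cycle2g // !inE => /orP[/eqP x1|/eqP //].
  by rewrite x1 order1 in ox2.
set z := x ^+ 2 in ox2 xu2.
have zz : z * z = 1 by have := expg_order z; rewrite ox2.
have cHK' a b : a \in H -> b \in K -> b * a = a * b.
  by move=> Ha Kb; apply: (centsP cHK).
have yy : y * y = 1 by have := expg_order y; rewrite oy.
have rev a b : a ^+ 2 = z -> a ^ b = a^-1 -> b * a = z * (a * b).
  move=> az ab; have aba : a * b * a = b by rewrite (conjgC a b) ab mulgKV.
  by rewrite -[LHS]mul1g -zz -{2}az -!mulgA (mulgA a b) aba.
exists z, y, (x * y), (x * u), (x * v); split.
  apply: clifford_rel_xyuv => //; try exact: cHK'.
  - by rewrite -order_gt1 ox2.
  - by rewrite xu2.
  - exact: rev.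
  - by apply: rev.
apply/eqP; rewrite eqEsubset; apply/andP; split; last first.
  rewrite gen_subG; apply/subsetP => t; rewrite !inE -orbA -orbA.
  have sH : H \subset R by rewrite -defR mulG_subl.
  have sK : K \subset R by rewrite -defR mulG_subr.
  have [Rx Ry] := (subsetP sH x Hx, subsetP sH y Hy).
  have [Ru Rv] := (subsetP sK u Ku, subsetP sK v Kv).
  by case/or4P=> /eqP ->; rewrite ?groupM.
set S := <<_>>.
have Sy : y \in S by rewrite mem_gen // !inE eqxx.
have Sx : x \in S by rewrite -(groupMr x Sy) mem_gen // !inE eqxx ?orbT.
have Su : u \in S by rewrite -(groupMl u Sx) mem_gen // !inE eqxx ?orbT.
have Sv : v \in S by rewrite -(groupMl v Sx) mem_gen // !inE eqxx ?orbT.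
rewrite -defR mul_subG // -?(sdprodW sdH) -?(pprodW ppK) mul_subG ?cycle_subG //.
Qed.

Local Close Scope group_scope.
Local Open Scope ring_scope.

(** * The Clifford module *)

(* Projecting p to an eigenspace of T0 gives (a, b) <> 0 there, and a^2 + b^2 <> 0 in GF(3)
   brings it back to the first basis vector. *)
Lemma irreducible_codes :
  let i q := vmul (vmul q T1) T2 in
  all (fun p => has (fun q => has (fun r => r \in [:: (p3, z3, z3, z3); (n3, z3, z3, z3)])
      [:: q; i q; vadd q (i q); vadd q (vopp (i q))])
    [:: vadd p (vmul p T0); vmul (vadd p (vopp (vmul p T0))) T1]) nonzero_vectors.
Proof. by vm_compute. Qed.

Section Frame.
Variables t0 t1 t2 t3 z : 'M['F_3]_4.
Hypotheses (z1 : z != 1%:M) (zz : z *m z = 1%:M).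
Hypotheses (t00 : t0 *m t0 = 1%:M) (t11 : t1 *m t1 = 1%:M)
           (t22 : t2 *m t2 = 1%:M) (t33 : t3 *m t3 = 1%:M).
Hypotheses (t0z : t0 *m z = z *m t0) (t1z : t1 *m z = z *m t1)
           (t2z : t2 *m z = z *m t2) (t3z : t3 *m z = z *m t3).
Hypotheses (t01 : t0 *m t1 = z *m (t1 *m t0)) (t02 : t0 *m t2 = z *m (t2 *m t0))
           (t03 : t0 *m t3 = z *m (t3 *m t0)) (t12 : t1 *m t2 = z *m (t2 *m t1))
           (t13 : t1 *m t3 = z *m (t3 *m t1)) (t23 : t2 *m t3 = z *m (t3 *m t2)).

(** At this stage [z] is only a nontrivial involution. The construction stays inside its eigenspace
    for -1, which the [t] preserve; once a basis is found there, [z] must be -1 everywhere. *)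
Definition negz (x : V) := x *m z = - x.

Lemma negz_t (t : 'M_4) x : t *m z = z *m t -> negz x -> negz (x *m t).
Proof. by rewrite /negz -mulmxA => -> xz; rewrite mulmxA xz mulNmx. Qed.

Lemma negz_anti (s t : 'M_4) x : s *m t = z *m (t *m s) -> negz x ->
  x *m s *m t = - (x *m t *m s).
Proof. by move=> st xz; rewrite -mulmxA st mulmxA xz mulNmx mulmxA. Qed.

Lemma sq_t (t : 'M_4) (x : V) : t *m t = 1%:M -> x *m t *m t = x.
Proof. by rewrite -mulmxA => ->; rewrite mulmx1. Qed.

Lemma negzD x y : negz x -> negz y -> negz (x + y).
Proof. by rewrite /negz mulmxDl opprD => -> ->. Qed.
Lemma negzN x : negz x -> negz (- x).
Proof. by rewrite /negz mulNmx => ->. Qed.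

Lemma exists_fixed_negz : exists e : V, [/\ e != 0, negz e & e *m t0 = e].
Proof.
have [u nu uz] : exists2 u : V, u != 0 & negz u.
  have : (1%:M - z) != 0 by rewrite subr_eq0 eq_sym.
  case/rowV0Pn => _ /submxP[w ->] nu; exists (w *m (1%:M - z)) => //.
  by rewrite /negz -mulmxA mulmxBl mul1mx zz -mulmxN opprB.
case: (eqVneq (u + u *m t0) 0) => [E|ne]; last first.
  exists (u + u *m t0); split=> //; first exact: negzD (negz_t t0z _).
  by rewrite mulmxDl sq_t // addrC.
have ut0 : u *m t0 = - u by apply/eqP; rewrite -addr_eq0 addrC E.
(* On this eigenspace [t1] anticommutes with [t0], so it exchanges the two eigenspaces of [t0]. *)
exists (u *m t1); split; last 1 first.
- have /eqP := negz_anti t01 uz; rewrite -eqr_oppLR => /eqP <-.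
  by rewrite ut0 mulNmx opprK.
- by apply: contraNneq nu => ut; rewrite -(sq_t u t11) ut mul0mx.
- exact: negz_t.
Qed.

Lemma addV3_eq0 (x : V) : x + x + x = 0.
Proof. by apply/rowP => k; rewrite !mxE; case: (x 0 k) => [[|[|[|]]] ?] //; apply/val_inj. Qed.

Lemma char3_identity (a b c d : V) : - c + - d + a = - a + b - c + (- b - a - d).
Proof.
apply/rowP => k; rewrite !mxE.
have -> : (- a 0 k + b 0 k - c 0 k + (- b 0 k - a 0 k - d 0 k)
  = - c 0 k - d 0 k + a 0 k - (a 0 k + a 0 k + a 0 k)) by ring.
by have /rowP/(_ k) := addV3_eq0 a; rewrite !mxE => ->; rewrite subr0.
Qed.

(** On the vectors fixed by [t0] in the eigenspace of [z], the maps [i] and [j] satisfy the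
    quaternion relations, and the condition on [v] is that [1 + i - j] annihilates it. The norm of
    this quaternion is 1 + 1 + 1 = 0, so its conjugate maps any [e] to a solution, up to sign. If
    that image vanishes, then [j e = i e - e], and [e + i e] is a nonzero solution. *)
Lemma exists_frame_vector : exists v : V, [/\ v != 0, negz v, v *m t0 = v
  & v *m t1 *m t3 = v + v *m t1 *m t2].
Proof.
have [e [ne ez et0]] := exists_fixed_negz.
pose i (x : V) := x *m t1 *m t2; pose j (x : V) := x *m t1 *m t3.
have iD x y : i (x + y) = i x + i y by rewrite /i !mulmxDl.
have jD x y : j (x + y) = j x + j y by rewrite /j !mulmxDl.
have iN x : i (- x) = - i x by rewrite /i !mulNmx.
have jN x : j (- x) = - j x by rewrite /j !mulNmx.
have iz x : negz x -> negz (i x) by move=> xz; do 2 apply: negz_t => //.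
have jz x : negz x -> negz (j x) by move=> xz; do 2 apply: negz_t => //.
have ii x : negz x -> i (i x) = - x.
  move=> xz; rewrite /i (negz_anti t12 (negz_t t2z (negz_t t1z xz))).
  by rewrite (sq_t _ t22) (sq_t _ t11).
have jj x : negz x -> j (j x) = - x.
  move=> xz; rewrite /j (negz_anti t13 (negz_t t3z (negz_t t1z xz))).
  by rewrite (sq_t _ t33) (sq_t _ t11).
have ij x : negz x -> j (i x) = - i (j x).
  move=> xz; rewrite /i /j.
  have -> : x *m t1 *m t2 *m t1 *m t3 = - (x *m t2 *m t3).
    by rewrite (negz_anti t12 xz) !mulNmx (sq_t _ t11).
  have -> : x *m t1 *m t3 *m t1 *m t2 = - (x *m t3 *m t2).
    by rewrite (negz_anti t13 xz) !mulNmx (sq_t _ t11).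
  by rewrite (negz_anti t23 xz).
have it0 x : negz x -> x *m t0 = x -> i x *m t0 = i x.
  move=> xz xt0; have xz1 := negz_t t1z xz.
  have /eqP := negz_anti t02 xz1; rewrite -eqr_oppLR => /eqP <-.
  have /eqP := negz_anti t01 xz; rewrite -eqr_oppLR => /eqP <-.
  by rewrite xt0 !mulNmx opprK.
have jt0 x : negz x -> x *m t0 = x -> j x *m t0 = j x.
  move=> xz xt0; have xz1 := negz_t t1z xz.
  have /eqP := negz_anti t03 xz1; rewrite -eqr_oppLR => /eqP <-.
  have /eqP := negz_anti t01 xz; rewrite -eqr_oppLR => /eqP <-.
  by rewrite xt0 !mulNmx opprK.
case: (eqVneq (- e + i e - j e) 0) => [E|ne'].
  have je : j e = i e - e by apply/esym/eqP; rewrite -subr_eq0 (addrC (i e)) E.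
  exists (e + i e); split.
  - apply: contraNneq ne => E'; have ie : i e = - e by apply/eqP; rewrite -addr_eq0 addrC E'.
    have ee : e + e = 0 by rewrite {1}(_ : e = - e) ?addNr // -(ii e ez) ie iN ie opprK.
    by rewrite -(addV3_eq0 e) ee add0r.
  - exact: negzD (iz _ ez).
  - by rewrite mulmxDl et0 it0.
  rewrite -/(j _) -/(i _) jD iD ij // je iD iN ii //; move: (i e) => f.
  by apply/rowP => k; rewrite !mxE; ring.
exists (- e + i e - j e); split=> //.
- by do 2 ?apply: negzD; try apply: negzN; auto.
- by rewrite !mulmxDl !mulNmx et0 it0 // jt0.
rewrite -/(j _) -/(i _) !jD !iD !(iN, jN) ij // ii // jj //.
rewrite opprK; move: (i e) (j e) (i (j e)) => f g h; exact: char3_identity.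
Qed.

Lemma clifford_frame : exists M : 'M['F_3]_4, [/\ M \in unitmx, z = - 1%:M &
  [/\ M *m t0 = toM T0 *m M, M *m t1 = toM T1 *m M, M *m t2 = toM T2 *m M
    & M *m t3 = toM T3 *m M]].
Proof.
have [v [nv vz vt0 vj]] := exists_frame_vector.
have [v1z v2z] := (negz_t t1z vz, negz_t t2z vz); have v12z := negz_t t2z v1z.
pose M : 'M['F_3]_4 := \matrix_i nth 0 [:: v; v *m t1 *m t2; v *m t1; v *m t2] i.
have decE a b c d : dec M (a, b, c, d) = toF a *: v + toF b *: (v *m t1 *m t2)
    + toF c *: (v *m t1) + toF d *: (v *m t2).
  by rewrite /dec mulmx_sum_row !big_ord_recl big_ord0 !rowK !mxE /= addr0 !addrA.
have anti' s t x : s *m t = z *m (t *m s) -> negz x -> x *m t *m s = - (x *m s *m t).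
  by move=> st xz; rewrite (negz_anti st xz) opprK.
have v121 : v *m t1 *m t2 *m t1 = - (v *m t2).
  by rewrite (anti' _ _ _ t12 v1z) (sq_t _ t11).
have vt3 : v *m t3 = - (v *m t1) + v *m t2.
  by rewrite -(sq_t (v *m t3) t11) (anti' _ _ _ t13 vz) vj mulNmx mulmxDl v121 opprD opprK.
have rowMt t m : (forall i, row i M *m t = dec M (nth vzero (rows m) i)) -> M *m t = toM m *m M.
  by move=> H; apply/row_matrixP => i; rewrite !row_mul row_toM H.
have Mt0 : M *m t0 = toM T0 *m M.
  apply: rowMt => i; rewrite rowK; elim/ord4P: i;
  rewrite /= decE /= !(scale0r, scale1r, scaleN1r, addr0, add0r).
  - by [].
  - by rewrite (anti' _ _ _ t02 v1z) (anti' _ _ _ t01 vz) vt0 mulNmx opprK.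
  - by rewrite (anti' _ _ _ t01 vz) vt0.
  - by rewrite (anti' _ _ _ t02 vz) vt0.
have Mt1 : M *m t1 = toM T1 *m M.
  apply: rowMt => i; rewrite rowK; elim/ord4P: i;
  rewrite /= decE /= !(scale0r, scale1r, scaleN1r, addr0, add0r).
  - by [].
  - by [].
  - by rewrite (sq_t _ t11).
  - by rewrite (anti' _ _ _ t12 vz).
have Mt2 : M *m t2 = toM T2 *m M.
  apply: rowMt => i; rewrite rowK; elim/ord4P: i;
  rewrite /= decE /= !(scale0r, scale1r, scaleN1r, addr0, add0r).
  - by [].
  - by rewrite (sq_t _ t22).
  - by [].
  - by rewrite (sq_t _ t22).
have Mt3 : M *m t3 = toM T3 *m M.
  apply: rowMt => i; rewrite rowK; elim/ord4P: i;
  rewrite /= decE /= !(scale0r, scale1r, scaleN1r, addr0, add0r).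
  - by [].
  - rewrite (negz_anti t23 v1z) vj mulmxDl (sq_t _ t22) opprD addrC.
    by [].
  - by [].
  - by rewrite (negz_anti t23 vz) vt3 mulmxDl mulNmx (sq_t _ t22) opprD opprK addrC.
(* The coordinate vectors [p] with [dec M p = 0] form a space invariant under the [T] matrices. By
   [irreducible_codes] a nonzero one would force the first basis vector into it, that is,
   [v = 0]. *)
have unitM : M \in unitmx.
  rewrite -row_free_unit -kermx_eq0; apply/rowV0P => w /sub_kermxP wM.
  rewrite -(ofVK w); move: (ofV w) (etrans (congr1 (mulmx^~ M) (ofVK w)) wM) => p.
  rewrite -/(dec M p) => p0.
  case: (eqVneq p vzero) => [->|]; first exact: toV0.
  rewrite -mem_nonzero => /(allP irreducible_codes)/hasP[q Hq /hasP[r Hr re]].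
  have e0 : dec M (p3, z3, z3, z3) != 0.
    by rewrite decE /= !(scale0r, scale1r, addr0).
  have zmul m t q' : M *m t = toM m *m M -> dec M q' = 0 -> dec M (vmul q' m) = 0.
    by move=> E q0; rewrite (dec_mul _ E) q0 mul0mx.
  have zadd q1 q2 : dec M q1 = 0 -> dec M q2 = 0 -> dec M (vadd q1 q2) = 0.
    by move=> q0 r0; rewrite dec_add q0 r0 addr0.
  have zopp q1 : dec M q1 = 0 -> dec M (vopp q1) = 0.
    by move=> q0; rewrite dec_opp q0 oppr0.
  have q0 : dec M q = 0.
    move: Hq; rewrite !inE => /orP[] /eqP ->; first exact/zadd/(zmul _ _ _ Mt0).
    exact/(zmul _ _ _ Mt1)/zadd/zopp/(zmul _ _ _ Mt0).
  have r0 : dec M r = 0.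
    have i0 := zmul _ _ _ Mt2 (zmul _ _ _ Mt1 q0).
    move: Hr; rewrite !inE => /or4P[] /eqP -> //; first exact: zadd.
    exact/zadd/zopp.
  move: re; rewrite !inE => /orP[] /eqP rE; move: e0; rewrite -?rE ?r0 ?eqxx //.
  by rewrite -[dec M _]opprK -dec_opp -[vopp _]rE r0 oppr0 eqxx.
have zM : z = - 1%:M.
  apply: (can_inj (mulKmx unitM)); rewrite mulmxN mulmx1.
  apply/row_matrixP => i; rewrite row_mul linearN /= !rowK.
  by elim/ord4P: i.
by exists M; split.
Qed.
End Frame.

(** * Elements of R and of its normaliser in a Clifford basis *)

Definition ofM (x : 'M['F_3]_4) : m4 :=
  (ofV (row 0 x), ofV (row 1 x), ofV (row 2%:R x), ofV (row 3%:R x)).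

Lemma ofMK : cancel ofM toM.
Proof. by move=> x; apply/row_matrixP; apply: ord4P; rewrite row_toM ofVK. Qed.

Definition e1 : v4 := (p3, z3, z3, z3).

Lemma frame_unique (X : 'M['F_3]_4) (a0 a1 a2 a3 : m4) :
    X *m toM a0 = toM T0 *m X -> X *m toM a1 = toM T1 *m X ->
    X *m toM a2 = toM T2 *m X -> X *m toM a3 = toM T3 *m X ->
  exists2 p, framed p a0 a1 a2 a3 & X = toM (frame p a1 a2).
Proof.
move=> E0 E1 E2 E3; pose p := ofV (dec X e1); exists p.
  apply/andP; split; apply/eqP/toV_inj; rewrite ?toV_add !toV_mul ofVK -?(dec_mul _ E0) //.
  by rewrite -!(dec_mul _ E1) -(dec_mul _ E2) -(dec_mul _ E3) -dec_add.
have XE i : row i X = dec X (nth vzero (rows mone) i).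
  by rewrite /dec -row_toM toM1 -row_mul mul1mx.
have pE : toV p = dec X e1 by rewrite ofVK.
apply/row_matrixP => i; rewrite row_toM XE; elim/ord4P: i.
- exact: esym pE.
- by rewrite -[RHS]/(toV (vmul (vmul p a1) a2)) !toV_mul pE -(dec_mul _ E1) -(dec_mul _ E2).
- by rewrite -[RHS]/(toV (vmul p a1)) toV_mul pE -(dec_mul _ E1).
- by rewrite -[RHS]/(toV (vmul p a2)) toV_mul pE -(dec_mul _ E2).
Qed.

(* An abstract group with a faithful representation keeps unification away from the slow
   group structure of {'GL_4(3)}. *)
Section Representation.
Variables (gT : finGroupType) (mat : gT -> 'M['F_3]_4).
Hypotheses (matM : forall x y, mat (x * y)%g = mat x *m mat y) (mat1 : mat 1%g = 1%:M)
  (mat_inj : injective mat).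

Lemma mat_unit x : mat x \in unitmx.
Proof.
have E := etrans (esym (matM x x^-1%g)) (etrans (congr1 mat (mulgV x)) mat1).
exact: (proj1 (mulmx1_unit E)).
Qed.

(** This says that [c] is the matrix of [x] in the basis of rows of [M], written without an
    inverse. *)
Definition crel (M : 'M['F_3]_4) (x : gT) (c : m4) := M *m mat x = toM c *m M.

Section Crel.
Variable M : 'M['F_3]_4.
Hypothesis uM : M \in unitmx.
Local Notation crel := (crel M).

Lemma crel_mul x y c d : crel x c -> crel y d -> crel (x * y)%g (mmul c d).
Proof.
by rewrite /crel matM toM_mul => Ex Ey; rewrite mulmxA Ex -(mulmxA _ M) Ey mulmxA.
Qed.

Lemma crel1 : crel 1%g mone.
Proof. by rewrite /crel mat1 toM1 mul1mx mulmx1. Qed.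

Lemma crel_eq x y c d : crel x c -> crel y d -> (x == y) = (c == d).
Proof.
move=> Ex Ey; apply/eqP/eqP => E.
  apply/toM_inj/(can_inj (mulmxK uM)); apply: etrans (esym Ex) _.
  by rewrite E.
by apply/mat_inj/(can_inj (mulKmx uM)); rewrite Ex Ey E.
Qed.

Lemma crel_exists x : exists c, crel x c.
Proof. by exists (ofM (M *m mat x *m invmx M)); rewrite /crel ofMK mulmxKV. Qed.

Lemma crel_opp x z c : mat z = - 1%:M -> crel x c -> crel (z * x)%g (mopp c).
Proof.
by move=> zE; rewrite /crel matM zE toM_opp !mulNmx mulmxN mul1mx => ->.
Qed.

Lemma crel_unit x c : crel x c -> toM c \in unitmx.
Proof.
move=> E; have : M *m mat x \in unitmx by rewrite unitmx_mul uM mat_unit.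
by rewrite E unitmx_mul => /andP[].
Qed.

Lemma crel_frame x c (s0 s1 s2 s3 : gT) (a0 a1 a2 a3 : m4) :
    crel s0 T0 -> crel s1 T1 -> crel s2 T2 -> crel s3 T3 ->
    crel (s0 ^ x)%g a0 -> crel (s1 ^ x)%g a1 -> crel (s2 ^ x)%g a2 -> crel (s3 ^ x)%g a3 ->
    crel x c -> exists2 p, framed p a0 a1 a2 a3 & c = frame p a1 a2.
Proof.
move=> S0 S1 S2 S3 A0 A1 A2 A3 Ex.
have H s T a : crel s T -> crel (s ^ x)%g a -> toM c *m toM a = toM T *m toM c.
  move=> Es Ea; rewrite -!toM_mul; congr toM; apply/eqP.
  by rewrite -(crel_eq (crel_mul Ex Ea) (crel_mul Es Ex)) -conjgC.
have [p fp E] := frame_unique (H _ _ _ S0 A0) (H _ _ _ S1 A1) (H _ _ _ S2 A2) (H _ _ _ S3 A3).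
by exists p => //; apply: toM_inj.
Qed.
End Crel.

(** The 32 elements of [R] in a Clifford basis. *)
Definition span_clifford : seq m4 := Eval vm_compute in
  reach [seq mmul^~ t | t <- [:: T0; T1; T2; T3]] mone.

Definition code_involutions : seq m4 :=
  [seq c <- span_clifford | (mmul c c == mone) && (c \notin [:: mone; mopp mone])].

Lemma span_clifford_closed :
  all (fun c => all (fun t => mmul c t \in span_clifford) [:: T0; T1; T2; T3]) span_clifford.
Proof. by vm_compute. Qed.

Lemma code_involutions_anti : all (fun c => all (fun d =>
  [|| d == c, d == mopp c | anti c d]) code_involutions) code_involutions.
Proof. by vm_compute. Qed.

(** Each of five pairwise anticommuting involutions commutes with their product, as the sign changes
    four times; in this group that leaves only 1 and -1. The successive filters keep the enumeration
    of quintuples small. *)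
Lemma code_product : let next s c := [seq d <- s | anti c d] in
  all (fun c0 => let s1 := next code_involutions c0 in
  all (fun c1 => let s2 := next s1 c1 in
  all (fun c2 => let s3 := next s2 c2 in
  all (fun c3 => let s4 := next s3 c3 in
  all (fun c4 => mmul (mmul (mmul (mmul c0 c1) c2) c3) c4 \in [:: mone; mopp mone])
  s4) s3) s2) s1) code_involutions.
Proof. by vm_compute. Qed.

Definition involution (z x : gT) := [&& x * x == 1, x != 1 & x != z]%g.

Lemma clifford_rel_frame (z t0 t1 t2 t3 : gT) : clifford_rel z [:: t0; t1; t2; t3] ->
  exists M, [/\ M \in unitmx, mat z = - 1%:M, crel M t0 T0, crel M t1 T1
    & crel M t2 T2 /\ crel M t3 T3].
Proof.
case=> z1 zz tz tt.
have [t00 t0z] := tz t0 (mem_head _ _).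
have [t11 t1z] : (t1 * t1 = 1 /\ t1 * z = z * t1)%g by apply: tz; rewrite !inE eqxx ?orbT.
have [t22 t2z] : (t2 * t2 = 1 /\ t2 * z = z * t2)%g by apply: tz; rewrite !inE eqxx ?orbT.
have [t33 t3z] : (t3 * t3 = 1 /\ t3 * z = z * t3)%g by apply: tz; rewrite !inE eqxx ?orbT.
have /andP[/and4P[/eqP t01 /eqP t02 /eqP t03 _]
  /andP[/and3P[/eqP t12 /eqP t13 _] /andP[/andP[/eqP t23 _] _]]] := tt.
have G1 (a b : gT) : (a * b = 1)%g -> mat a *m mat b = 1%:M by rewrite -matM => ->; apply: mat1.
have G2 (a b c d : gT) : (a * b = c * d)%g -> mat a *m mat b = mat c *m mat d.
  by rewrite -!matM => ->.
have G3 (a b c d e : gT) : (a * b = e * (c * d))%g -> mat a *m mat b = mat e *m (mat c *m mat d).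
  by rewrite -!matM => ->.
have z1' : mat z != 1%:M by apply: contraNneq z1 => E; apply/eqP/mat_inj; rewrite E mat1.
have [M [uM zE [E0 E1 E2 E3]]] := clifford_frame z1' (G1 _ _ zz) (G1 _ _ t00) (G1 _ _ t11)
  (G1 _ _ t22) (G1 _ _ t33) (G2 _ _ _ _ t0z) (G2 _ _ _ _ t1z) (G2 _ _ _ _ t2z) (G2 _ _ _ _ t3z)
  (G3 _ _ _ _ _ t01) (G3 _ _ _ _ _ t02) (G3 _ _ _ _ _ t03) (G3 _ _ _ _ _ t12)
  (G3 _ _ _ _ _ t13) (G3 _ _ _ _ _ t23).
by exists M.
Qed.

Lemma DnQ1_frame (R : {group gT}) : (R \isog 'D^1*Q)%g ->
  exists M (z t0 t1 t2 t3 : gT), [/\ M \in unitmx, mat z = - 1%:M,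
    [/\ t0 \in R, t1 \in R, t2 \in R & t3 \in R], z \in R
    & [/\ crel M t0 T0, crel M t1 T1, crel M t2 T2, crel M t3 T3
     & forall x, x \in R -> exists2 c, c \in span_clifford & crel M x c]].
Proof.
case/DnQ1_generators=> z [t0 [t1 [t2 [t3 [rel RE]]]]].
have [z1 zz tz tt] := rel; have /andP[/andP[/eqP t01 _] _] := tt.
have [M [uM zE E0 E1 [E2 E3]]] := clifford_rel_frame rel.
have Rt : [/\ t0 \in R, t1 \in R, t2 \in R & t3 \in R].
  by rewrite RE !mem_gen // !inE eqxx ?orbT.
exists M, z, t0, t1, t2, t3; split=> //.
  have -> : z = (t0 * t1 * (t1 * t0)^-1)%g by rewrite t01 mulgK.
  by case: Rt => *; rewrite !groupM // groupV groupM.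
split=> // x; rewrite RE => /gen_prodgP[n [c Ec ->]].
elim: n c Ec => [|n IH] c Ec.
  by rewrite big_ord0; exists mone; rewrite ?inE //; apply: crel1.
rewrite big_ord_recr /=.
have [d Hd Ed] := IH (fun i => c (widen_ord (leqnSn n) i)) (fun i => Ec _).
have /allP step := allP span_clifford_closed d Hd.
have := Ec ord_max; rewrite !inE -orbA -orbA => /or4P[] /eqP ->.
- by exists (mmul d T0); [apply: step; rewrite !inE eqxx ?orbT | apply: crel_mul].
- by exists (mmul d T1); [apply: step; rewrite !inE eqxx ?orbT | apply: crel_mul].
- by exists (mmul d T2); [apply: step; rewrite !inE eqxx ?orbT | apply: crel_mul].
- by exists (mmul d T3); [apply: step; rewrite !inE eqxx ?orbT | apply: crel_mul].
Qed.
End Representation.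

Definition mzero : m4 := (vzero, vzero, vzero, vzero).

(** Schur's lemma in coordinates: the Clifford algebra acts as the full matrix algebra, so only
    scalar matrices commute with all [T] matrices. *)
Lemma framed_clifford : all (fun p => framed p T0 T1 T2 T3 ==>
  (frame p T1 T2 \in [:: mone; mopp mone; mzero])) vectors.
Proof. by vm_compute. Qed.

Lemma signed_clifford_involutions :
  all (fun c => (mmul c c == mone) && (c \notin [:: mone; mopp mone])) signed_clifford.
Proof. by vm_compute. Qed.

Section Representation.
Variables (gT : finGroupType) (mat : gT -> 'M['F_3]_4).
Hypotheses (matM : forall x y, mat (x * y)%g = mat x *m mat y) (mat1 : mat 1%g = 1%:M)
  (mat_inj : injective mat).

Section Involutions.
Variables (z : gT) (zE : mat z = - 1%:M).

Lemma mat_opp x : mat (z * x)%g = - mat x.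
Proof. by rewrite matM zE mulNmx mul1mx. Qed.

Lemma zC x : (z * x = x * z)%g.
Proof. by apply: mat_inj; rewrite mat_opp matM zE mulmxN mulmx1. Qed.

Lemma zz : (z * z = 1)%g.
Proof. by apply: mat_inj; rewrite mat_opp zE opprK mat1. Qed.

Lemma zK x : (z * (z * x) = x)%g.
Proof. by rewrite mulgA zz mul1g. Qed.

Lemma zJ x : (z ^ x = z)%g.
Proof. by rewrite conjgE zC mulKg. Qed.

Lemma involutionJ x g : involution z (x ^ g)%g = involution z x.
Proof.
by rewrite /involution -conjMg !conjg_eq1 -{1}(zJ g) (inj_eq (conjg_inj g)).
Qed.

Lemma z_neq1 : z != 1%g.
Proof.
apply/eqP => z1; have := zE; rewrite z1 mat1 => /matrixP/(_ 0 0).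
by rewrite !mxE.
Qed.

Section Codes.
Variable (M : 'M['F_3]_4) (uM : M \in unitmx).
Local Notation crel := (crel mat M).
Local Notation crelM := (crel_mul matM).
Local Notation crelE := (crel_eq mat_inj uM).
Local Notation crelN := (crel_opp matM zE).
Local Notation crel1 := (crel1 mat1 M).

Lemma crelz : crel z (mopp mone).
Proof. by have := crelN crel1; rewrite mulg1. Qed.

Lemma involution_code x c : crel x c ->
  involution z x = (mmul c c == mone) && (c \notin [:: mone; mopp mone]).
Proof.
move=> xc; rewrite /involution (crelE (crelM xc xc) crel1) (crelE xc crel1) (crelE xc crelz).
by rewrite !inE negb_or.
Qed.

Lemma crel_neq0 x c : crel x c -> c != mzero.
Proof.
move=> /(crel_unit matM mat1 uM); apply: contraTneq => ->.
rewrite (_ : toM mzero = 0) ?unitmxE ?det0 ?unitr0 //.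
by apply/row_matrixP => i; rewrite row_toM row0 -toV0; elim/ord4P: i.
Qed.

(** If [f] changed the sign of [s], then so would its odd power [f ^+ 5 = 1]. *)
Lemma conj5 s f : (f ^+ 5 = 1)%g -> (s ^ f = z * s)%g -> False.
Proof.
move=> f5 sf; have ssf : ((s ^ f) ^ f = s)%g by rewrite sf conjMg zJ sf zK.
have : (s ^ (f ^+ 5) = s)%g by rewrite f5 conjg1.
rewrite !expgS expg0 mulg1 !conjgM !ssf sf => /(canRL (mulgK _))/eqP.
by rewrite mulgV (negPf z_neq1).
Qed.

(** Otherwise [f] keeps every pair of opposite involutions, hence by [conj5] every involution; it
    then commutes with the generators and is 1 or [z], whose orders are not 5. *)
Lemma order5_moves (R : {group gT}) (t0 t1 t2 t3 f : gT) :
    crel t0 T0 -> crel t1 T1 -> crel t2 T2 -> crel t3 T3 ->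
    t0 \in R -> t1 \in R -> t2 \in R -> t3 \in R -> #[f]%g = 5%N ->
  exists2 s, s \in R & involution z s /\ (s ^ f)%g \notin [:: s; z * s]%g.
Proof.
move=> E0 E1 E2 E3 R0 R1 R2 R3 of5.
have f5 : (f ^+ 5 = 1)%g by rewrite -of5 expg_order.
have [s /and3P[Rs Is ns]|H] :=
  pickP (fun s => [&& s \in R, involution z s & (s ^ f)%g \notin [:: s; z * s]%g]).
  by exists s.
have fixed t T : T \in signed_clifford -> crel t T -> t \in R -> crel (t ^ f)%g T.
  move=> cT Et Rt; have := H t.
  rewrite Rt (involution_code Et) (allP signed_clifford_involutions _ cT) /= => /negbFE.
  by rewrite !inE => /orP[/eqP ->|/eqP /(conj5 f5)].
have [c Ec] := crel_exists mat uM f.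
have [p fp cE] := crel_frame matM mat_inj uM E0 E1 E2 E3 (fixed _ T0 isT E0 R0)
  (fixed _ T1 isT E1 R1) (fixed _ T2 isT E2 R2) (fixed _ T3 isT E3 R3) Ec.
have /implyP/(_ fp) := allP framed_clifford p (mem_vectors p).
rewrite -cE !inE (negPf (crel_neq0 Ec)) orbF -(crelE Ec crel1) -(crelE Ec crelz).
by case/orP=> /eqP fE; move: of5; [rewrite fE order1 |
  have := order_dvdn f 2; rewrite fE expgS expg1 zz eqxx -fE => + o5; rewrite o5].
Qed.
End Codes.

(** These facts are stated without a basis: any Clifford basis proves them, and the one adapted to
    an element of order 5 is constructed from them afterwards. *)
Lemma DnQ1_involutions (R : {group gT}) : (R \isog 'D^1*Q)%g ->
  [/\ z \in R,
    {in R &, forall x y, involution z x -> involution z y ->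
      [|| y == x, y == (z * x)%g | (x * y)%g == (z * (y * x))%g]},
    forall s0 s1 s2 s3 s4,
      all (fun x => (x \in R) && involution z x) [:: s0; s1; s2; s3; s4] ->
      pairwise (fun x y => (x * y)%g == (z * (y * x))%g) [:: s0; s1; s2; s3; s4] ->
      (s0 * s1 * s2 * s3 * s4)%g \in [:: 1%g; z]
  & forall f, #[f]%g = 5%N ->
      exists2 s, s \in R & involution z s /\ (s ^ f)%g \notin [:: s; z * s]%g].
Proof.
move=> /(DnQ1_frame matM mat1 mat_inj).
case=> [M [z' [t0 [t1 [t2 [t3 [uM z'E [R0 R1 R2 R3] Rz [E0 E1 E2 E3 HR]]]]]]]].
have {z'E} ez : z' = z by apply: mat_inj; rewrite z'E zE.
rewrite {}ez in Rz.
have code x : x \in R -> involution z x -> exists2 c, c \in code_involutions & crel mat M x c.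
  move=> /HR[c sc Ec] ix; exists c => //.
  by rewrite mem_filter sc andbT -(involution_code uM Ec).
have antiE x y c d : crel mat M x c -> crel mat M y d ->
    ((x * y)%g == (z * (y * x))%g) = anti c d.
  by move=> Ex Ey; rewrite (crel_eq mat_inj uM (crel_mul matM Ex Ey)
    (crel_opp matM zE (crel_mul matM Ey Ex))).
split=> //.
- move=> x y Rx Ry /(code x Rx)[c ic Ec] /(code y Ry)[d id Ed].
  rewrite (antiE _ _ _ _ Ec Ed) (crel_eq mat_inj uM Ed Ec).
  rewrite (crel_eq mat_inj uM Ed (crel_opp matM zE Ec)).
  exact: (allP (allP code_involutions_anti c ic) d id).
- move=> s0 s1 s2 s3 s4 /and5P[/andP[S0 I0] /andP[S1 I1] /andP[S2 I2] /andP[S3 I3] /andP[/andP[S4 I4] _]].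
  have [[c0 J0 C0] [c1 J1 C1] [c2 J2 C2]] := And3 (code _ S0 I0) (code _ S1 I1) (code _ S2 I2).
  have [[c3 J3 C3] [c4 J4 C4]] := conj (code _ S3 I3) (code _ S4 I4).
  case/andP=> /and5P[A01 A02 A03 A04 _] /andP[/and4P[A12 A13 A14 _]
    /andP[/and3P[A23 A24 _] /andP[/andP[A34 _] _]]].
  rewrite !inE (crel_eq mat_inj uM (crel_mul matM (crel_mul matM (crel_mul matM
    (crel_mul matM C0 C1) C2) C3) C4) (crel1 mat1 M)).
  rewrite (crel_eq mat_inj uM (crel_mul matM (crel_mul matM (crel_mul matM
    (crel_mul matM C0 C1) C2) C3) C4) (crelz M)).
  rewrite (antiE _ _ _ _ C0 C1) in A01; rewrite (antiE _ _ _ _ C0 C2) in A02.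
  rewrite (antiE _ _ _ _ C0 C3) in A03; rewrite (antiE _ _ _ _ C0 C4) in A04.
  rewrite (antiE _ _ _ _ C1 C2) in A12; rewrite (antiE _ _ _ _ C1 C3) in A13.
  rewrite (antiE _ _ _ _ C1 C4) in A14; rewrite (antiE _ _ _ _ C2 C3) in A23.
  rewrite (antiE _ _ _ _ C2 C4) in A24; rewrite (antiE _ _ _ _ C3 C4) in A34.
  have := code_product; cbv zeta.
  move: code_involutions J0 J1 J2 J3 J4 => I J0 J1 J2 J3 J4 H.
  have m1 : c1 \in [seq d <- I | anti c0 d] by rewrite mem_filter A01.
  have m2 : c2 \in [seq d <- [seq d <- I | anti c0 d] | anti c1 d].
    by rewrite !mem_filter A02 A12.
  have m3 : c3 \in [seq d <- [seq d <- [seq d <- I | anti c0 d]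
      | anti c1 d] | anti c2 d] by rewrite !mem_filter A03 A13 A23.
  have := allP (allP (allP (allP (allP H c0 J0) c1 m1) c2 m2) c3 m3) c4.
  by rewrite !mem_filter A04 A14 A24 A34 !inE; apply.
- by move=> f; apply: (order5_moves uM E0 E1 E2 E3 R0 R1 R2 R3).
Qed.
End Involutions.
End Representation.

(** * Elements of order 5 and 3 that normalise R *)

Definition pow5 (c : m4) := mmul c (mmul c (mmul c (mmul c c))).

(** The intertwining relations determine the matrix up to a scalar; the fifth power excludes 0 and
    fixes the sign, since the fifth power of [- f0] is -1. *)
Lemma framed_shift : all (fun p => framed p T1 T2 T3 T4 ==>
  (pow5 (frame p T2 T3) == mone) ==> (frame p T2 T3 == f0)) vectors.
Proof. by vm_compute. Qed.

Lemma mem_signed T : T \in clifford -> T \in signed_clifford.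
Proof. by move=> cT; rewrite mem_cat; apply/orP; left. Qed.

Lemma mem_signed_opp T : T \in clifford -> mopp T \in signed_clifford.
Proof. by move=> cT; rewrite mem_cat; apply/orP; right; apply: map_f. Qed.

Section Representation.
Variables (gT : finGroupType) (mat : gT -> 'M['F_3]_4).
Hypotheses (matM : forall x y, mat (x * y)%g = mat x *m mat y) (mat1 : mat 1%g = 1%:M)
  (mat_inj : injective mat).
Variables (R : {group gT}) (hR : (R \isog 'D^1*Q)%g).

Lemma five_involutions f : f \in 'N(R)%g -> #[f]%g = 5%N ->
  exists z s, let t k := (s ^ (f ^+ k))%g in
   [/\ mat z = - 1%:M, z \in R, forall k, t k \in R /\ involution z (t k),
      (forall j k, (j < k < 5)%N -> t j * t k = z * (t k * t j))%g
    & (t 0%N * t 1%N * t 2%N * t 3%N * t 4%N = 1)%g].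
Proof.
move=> Nf of5; have f5 : (f ^+ 5 = 1)%g by rewrite -of5 expg_order.
have [M [z [t0 [t1 [t2 [t3 [_ zE _ _ _]]]]]]] := DnQ1_frame matM mat1 mat_inj hR.
have [Rz R1 Rprod R2] := DnQ1_involutions matM mat1 mat_inj zE hR.
have [s Rs [Is ns]] := R2 f of5.
have zC := zC matM mat_inj zE; have zz := zz matM mat1 mat_inj zE.
have zK := zK matM mat1 mat_inj zE; have zJ := zJ matM mat_inj zE.
pose P n := (s ^ (f ^+ n))%g \in [:: s; z * s]%g.
have PD m n : P m -> P n -> P (m + n)%N.
  rewrite /P !inE expgD conjgM => /orP[] /eqP -> => [//|].
  by rewrite conjMg zJ => /orP[] /eqP ->; rewrite ?zK eqxx ?orbT.
have Pmod n : P (5 + n)%N = P n by rewrite /P expgD f5 mul1g.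
have nP m : (0 < m < 5)%N -> ~~ P m.
  have nP1 : ~~ P 1%N by rewrite /P expg1.
  (* Each such [m] has a multiple congruent to 1 modulo 5, namely 3 * 2 = 6, 2 * 3 = 6 and 4 * 4 =
     16, so keeping the pair at [m] would mean keeping it at 1. *)
  case: m => [|[|[|[|[|m]]]]] //= _.
  - by apply: contra nP1 => P2; rewrite -Pmod; apply: (PD 2%N 4%N P2 (PD 2%N 2%N P2 P2)).
  - by apply: contra nP1 => P3; rewrite -Pmod; apply: (PD 3%N 3%N P3 P3).
  - apply: contra nP1 => P4; have P8 := PD 4%N 4%N P4 P4.
    by rewrite -Pmod -Pmod -Pmod; apply: (PD 8%N 8%N P8 P8).
have inv_conj x k : involution z x -> involution z (x ^ (f ^+ k))%g.
  by rewrite (involutionJ matM mat_inj zE).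
have R_conj x k : x \in R -> (x ^ (f ^+ k))%g \in R.
  by move=> Rx; rewrite memJ_norm // groupX.
have anti x : x \in R -> involution z x -> (forall m, (0 < m < 5)%N -> (x ^ (f ^+ m))%g \notin [:: x; z * x]%g) ->
  forall j k, (j < k < 5)%N -> (x ^ (f ^+ j) * x ^ (f ^+ k) = z * (x ^ (f ^+ k) * x ^ (f ^+ j)))%g.
  move=> Rx Ix nx j k /andP[jk k5].
  have := R1 _ _ (R_conj x j Rx) (R_conj x k Rx) (inv_conj x j Ix) (inv_conj x k Ix).
  have kE : (f ^+ k = f ^+ (k - j) * f ^+ j)%g by rewrite -expgD subnK // ltnW.
  have := nx (k - j)%N; rewrite subn_gt0 jk (leq_ltn_trans (leq_subr _ _) k5) => /(_ isT).
  rewrite !inE negb_or => /andP[n1 n2].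
  rewrite kE conjgM (inj_eq (conjg_inj _)) (negPf n1) -{1}(zJ (f ^+ j)%g) -conjMg.
  by rewrite (inj_eq (conjg_inj _)) (negPf n2) => /eqP.
have prod x : x \in R -> involution z x -> (forall m, (0 < m < 5)%N -> (x ^ (f ^+ m))%g \notin [:: x; z * x]%g) ->
  let t k := (x ^ (f ^+ k))%g in (t 0%N * t 1%N * t 2%N * t 3%N * t 4%N)%g \in [:: 1%g; z].
  move=> Rx Ix nx; apply: Rprod.
    by apply/allP => y; rewrite !inE => H; move: H; do ?[case/predU1P=> [->|]] => [|||| /eqP ->];
      rewrite R_conj ?inv_conj.
  by rewrite /=; do ?[apply/andP; split] => //; apply/eqP; apply: anti.
have /= := prod s Rs Is nP; rewrite !inE => /orP[/eqP p1|/eqP pz].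
  by exists z, s; split=> //; [split; [exact: R_conj | exact: inv_conj] | exact: anti].
(* When the product is [z], replacing [s] by [z * s] multiplies it by [z ^+ 5 = z] and makes it
   1. *)
have zsJ x : ((z * s) ^ x = z * s ^ x)%g by rewrite conjMg zJ.
have Izs : involution z (z * s)%g.
  have /and3P[/eqP ss s1 sz] := Is; rewrite /involution -mulgA (mulgA s) -zC -mulgA ss mulg1 zz eqxx /=.
  by apply/andP; split; [apply: contraNneq sz | apply: contraNneq s1] => E;
    rewrite -(zK s) E ?zz ?mulg1.
have nzs m : (0 < m < 5)%N -> ((z * s) ^ (f ^+ m))%g \notin [:: z * s; z * (z * s)]%g.
  move=> /nP; rewrite zsJ /P !inE !(inj_eq (mulgI z)).
  by [].
have Rzs : (z * s)%g \in R by rewrite groupM.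
exists z, (z * s)%g; split=> //.
- by split; [exact: R_conj | exact: inv_conj].
- exact: anti.
rewrite /= !zsJ; move: pz.
move: (s ^ (f ^+ 0))%g (s ^ (f ^+ 1))%g (s ^ (f ^+ 2))%g (s ^ (f ^+ 3))%g (s ^ (f ^+ 4))%g.
move=> a b c d e abcde.
have step x y : (x * (z * y) = z * (x * y))%g by rewrite !mulgA zC.
by rewrite !(step, zK) -!mulgA !zK !mulgA -?mulgA in abcde *; rewrite abcde.
Qed.

Lemma clifford_frame_order5 f : f \in 'N(R)%g -> #[f]%g = 5%N ->
  exists M z, [/\ M \in unitmx, mat z = - 1%:M, crel mat M f f0,
    {in R, forall y, involution z y -> exists2 c, c \in signed_clifford & crel mat M y c}
    & {in signed_clifford, forall c, exists2 y, y \in R & involution z y /\ crel mat M y c}].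
Proof.
move=> Nf of5; have [z [s [zE Rz Rt anti prod]]] := five_involutions Nf of5.
pose t k := (s ^ (f ^+ k))%g.
have t_sq k : (t k * t k = 1)%g by have [_ /and3P[/eqP]] := Rt k.
have zC := zC matM mat_inj zE.
have [|M [uM _ E0 E1 [E2 E3]]] := @clifford_rel_frame _ _ matM mat1 mat_inj z (t 0%N) (t 1%N) (t 2%N) (t 3%N).
  split; first exact: (z_neq1 mat1 zE).
  - exact: (zz matM mat1 mat_inj zE).
  - by move=> x; rewrite !inE => /or4P[] /eqP ->; rewrite t_sq zC.
  by rewrite /=; do ?[apply/andP; split] => //; apply/eqP; apply: anti.
have E4 : crel mat M (t 4%N) T4.
  have Ew := crel_mul matM (crel_mul matM (crel_mul matM E0 E1) E2) E3.
  rewrite (_ : mmul _ _ = T4) in Ew; last by vm_compute.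
  (* The product of the first four is its own inverse, and its product with [t 4] is 1. *)
  suff -> : t 4%N = (t 0%N * t 1%N * t 2%N * t 3%N)%g by [].
  have ww : (t 0%N * t 1%N * t 2%N * t 3%N * (t 0%N * t 1%N * t 2%N * t 3%N) = 1)%g.
    by apply/eqP; rewrite (crel_eq mat_inj uM (crel_mul matM Ew Ew) (crel1 mat1 M)).
  by apply: (mulgI (t 0%N * t 1%N * t 2%N * t 3%N)%g); rewrite prod ww.
have T_t T : T \in clifford -> exists2 k, (k < 5)%N & crel mat M (t k) T.
  by rewrite !inE; do ?[case/predU1P=> [->|]] => [|||| /eqP ->];
    [exists 0%N | exists 1%N | exists 2%N | exists 3%N | exists 4%N].
have t_T k : (k < 5)%N -> exists2 T, T \in clifford & crel mat M (t k) T.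
  by case: k => [|[|[|[|[|]]]]] // _; [exists T0 | exists T1 | exists T2 | exists T3 | exists T4].
have zK := zK matM mat1 mat_inj zE.
exists M, z; split=> //.
- have [c Ec] := crel_exists mat uM f.
  have tS k T : crel mat M (t k.+1) T -> crel mat M (t k ^ f)%g T by rewrite -conjgM -expgSr.
  have [p fp cE] := crel_frame matM mat_inj uM E0 E1 E2 E3
    (tS _ _ E1) (tS _ _ E2) (tS _ _ E3) (tS _ _ E4) Ec.
  have := allP framed_shift p (mem_vectors p); rewrite fp -cE => /implyP/(_ isT)/implyP H.
  rewrite -(eqP (H _)) //.
  have /= <- := crel_eq mat_inj uM (crel_mul matM Ec (crel_mul matM Ec (crel_mul matM Ec
    (crel_mul matM Ec Ec)))) (crel1 mat1 M).
  by have : ((f ^+ 5)%g == 1%g); [rewrite -of5 expg_order | rewrite !expgS expg0 mulg1].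
- move=> y Ry Iy; have R1 := let: And4 _ R1 _ _ := DnQ1_involutions matM mat1 mat_inj zE hR in R1.
  have [|H] := boolP (has (fun k => y \in [:: t k; z * t k]%g) (iota 0 5)).
    case/hasP=> k; rewrite mem_iota => /andP[_ k5]; have [T cT ET] := t_T k k5.
    rewrite !inE => /orP[] /eqP ->; first by exists T; [apply: mem_signed |].
    by exists (mopp T); [apply: mem_signed_opp | apply: (crel_opp matM zE)].
  (* An involution outside the five pairs anticommutes with all five [t k]. Moving it across their
     product, which is 1, multiplies it by [z ^+ 5 = z], so [z] would be 1. *)
  have ya k : (k < 5)%N -> (y * t k = z * (t k * y))%g.
    move=> k5; have [Rk Ik] := Rt k.
    have := hasPn H k; rewrite mem_iota k5 => /(_ isT); rewrite !inE negb_or => /andP[n1 n2].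
    have := R1 _ _ Rk Ry Ik Iy; rewrite (negPf n1) (negPf n2) /= => /eqP ->.
    by rewrite zK.
  have yz x : (y * (z * x) = z * (y * x))%g by rewrite !mulgA zC.
  have yt k x : (k < 5)%N -> (y * (t k * x) = z * (t k * (y * x)))%g.
    by move=> /ya H5; rewrite mulgA H5 !mulgA.
  have tz k x : (t k * (z * x) = z * (t k * x))%g.
    by rewrite mulgA -zC -mulgA.
  have prod' : (t 0%N * (t 1%N * (t 2%N * (t 3%N * t 4%N))) = 1)%g.
    by move: prod; rewrite -!mulgA.
  have /negP[] := z_neq1 mat1 zE; apply/eqP/(mulIg y).
  rewrite mul1g -[RHS]mulg1 -[in RHS]prod' !yt // ya // !tz !zK.
  by congr (_ * _)%g; rewrite -[LHS]mul1g -prod' !mulgA.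
move=> c; rewrite mem_cat => /orP[/T_t[k k5 Ek]|/mapP[T cT ->]].
  by exists (t k); [exact: (proj1 (Rt k)) | split=> //; exact: (proj2 (Rt k))].
have [k k5 Ek] := T_t T cT; have Ezk := crel_opp matM zE Ek.
exists (z * t k)%g; first by rewrite groupM // (proj1 (Rt k)).
split=> //; rewrite (involution_code matM mat1 mat_inj zE uM Ezk).
exact: (allP signed_clifford_involutions _ (mem_signed_opp cT)).
Qed.

Lemma order3_code M z h c : M \in unitmx -> mat z = - 1%:M ->
    {in R, forall y, involution z y -> exists2 c, c \in signed_clifford & crel mat M y c} ->
    {in signed_clifford, forall c, exists2 y, y \in R & involution z y /\ crel mat M y c} ->
    h \in 'N(R)%g -> #[h]%g = 3%N -> crel mat M h c -> c \in order3.
Proof.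
move=> uM zE RC CR Nh oh3 Ec.
have lift T : T \in clifford -> exists2 s, crel mat M s T &
    exists2 a, a \in signed_clifford & crel mat M (s ^ h)%g a.
  move=> /mem_signed/CR[s Rs [Is Es]]; exists s => //.
  apply: RC; first by rewrite memJ_norm.
  by rewrite (involutionJ matM mat_inj zE).
have [s0 E0 [a0 A0 F0]] := lift T0 isT; have [s1 E1 [a1 A1 F1]] := lift T1 isT.
have [s2 E2 [a2 A2 F2]] := lift T2 isT; have [s3 E3 [a3 A3 F3]] := lift T3 isT.
have [p fp cE] := crel_frame matM mat_inj uM E0 E1 E2 E3 F0 F1 F2 F3 Ec.
have anti_lift s s' T T' a a' : crel mat M s T -> crel mat M s' T' ->
    crel mat M (s ^ h)%g a -> crel mat M (s' ^ h)%g a' -> anti T T' -> anti a a'.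
  move=> Es Es' Ea Ea'.
  rewrite /anti -(crel_eq mat_inj uM (crel_mul matM Es Es') (crel_opp matM zE (crel_mul matM Es' Es))).
  rewrite -(crel_eq mat_inj uM (crel_mul matM Ea Ea') (crel_opp matM zE (crel_mul matM Ea' Ea))).
  by move=> /eqP ss; rewrite -!conjMg ss (conjMg z) (zJ matM mat_inj zE).
rewrite mem_filter; apply/andP; split.
  rewrite -(crel_eq mat_inj uM (crel_mul matM Ec (crel_mul matM Ec Ec)) (crel1 mat1 M)).
  rewrite -(crel_eq mat_inj uM Ec (crel1 mat1 M)) -(order_eq1 h) oh3 andbT.
  by have := expg_order h; rewrite oh3 !expgS expg0 mulg1 => ->; rewrite eqxx.
have a01 : anti a0 a1 by apply: anti_lift E0 E1 F0 F1 _; vm_compute.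
have a02 : anti a0 a2 by apply: anti_lift E0 E2 F0 F2 _; vm_compute.
have a03 : anti a0 a3 by apply: anti_lift E0 E3 F0 F3 _; vm_compute.
have a12 : anti a1 a2 by apply: anti_lift E1 E2 F1 F2 _; vm_compute.
have a13 : anti a1 a3 by apply: anti_lift E1 E3 F1 F3 _; vm_compute.
have a23 : anti a2 a3 by apply: anti_lift E2 E3 F2 F3 _; vm_compute.
apply/flatten_mapP; exists a0; first exact: A0.
apply/flatten_mapP; exists a1; first by rewrite mem_filter a01; exact: A1.
apply/flatten_mapP; exists a2; first by rewrite mem_filter a02 a12; exact: A2.
apply/flatten_mapP; exists a3; first by rewrite mem_filter a03 a13 a23; exact: A3.
by apply/mapP; exists p; [rewrite mem_filter fp; exact: mem_vectors | exact: cE].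
Qed.

End Representation.

(** * Blocks through the origin *)

Lemma card_fibers (T T' : finType) (f : T -> T') (A : {set T}) (n : nat) :
    {in A, forall x, #|[set y in A | f y == f x]| = n} -> #|A| = (#|f @: A| * n)%N.
Proof.
move=> fib; rewrite -sum1_card (partition_big_imset f) /= -sum_nat_const.
apply: eq_bigr => _ /imsetP[x Ax ->]; rewrite -(fib x Ax) -sum1_card.
by apply: eq_bigl => y; rewrite inE.
Qed.

Lemma double_count (T U : finType) (S : {set T}) (F : T -> {set U}) :
  (\sum_(B in S) #|F B| = \sum_x #|[set B in S | x \in F B]|)%N.
Proof.
under eq_bigr do rewrite -sum1_card.
rewrite (exchange_big_dep predT) //=; apply: eq_bigr => x _.
by rewrite -sum1_card; apply: eq_bigl => B; rewrite inE.
Qed.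

Lemma count_enum (T : finType) (S : {set T}) (a : pred T) :
  count a (enum S) = #|[set B in S | a B]|.
Proof.
rewrite -size_filter -(card_uniqP (filter_uniq a (enum_uniq S))); apply: eq_card => B.
by rewrite inE mem_filter mem_enum andbC.
Qed.

Definition shift (B : {set V}) (c : V) : {set V} := [set x + c | x in B].

Lemma mem_shift B c x : (x \in shift B c) = (x - c \in B).
Proof.
apply/imsetP/idP => [[y By ->]|Bx]; first by rewrite addrK.
by exists (x - c); rewrite // subrK.
Qed.

Lemma shiftD B c d : shift (shift B c) d = shift B (c + d).
Proof. by apply/setP => x; rewrite !mem_shift opprD addrA addrAC. Qed.

Lemma shift0 B : shift B 0 = B.
Proof. by apply/setP => x; rewrite mem_shift subr0. Qed.

Lemma img_shift g B c : img g (shift B c) = shift (img g B) (c *m g).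
Proof.
apply/setP => x; apply/imsetP/imsetP => [[_ /imsetP[y By ->] ->]|[_ /imsetP[y By ->] ->]].
  by exists (y *m g); [apply: imset_f | rewrite mulmxDl].
by exists (y + c); [apply: imset_f | rewrite mulmxDl].
Qed.

Lemma img1 B : img 1%:M B = B.
Proof. by rewrite /img (eq_imset _ (@mulmx1 _ _ _)) imset_id. Qed.

Lemma imgM g h B : img (g *m h) B = img h (img g B).
Proof. by rewrite /img -imset_comp; apply: eq_imset => x /=; rewrite mulmxA. Qed.

Lemma mem_img g B x : g \in unitmx -> (x *m g \in img g B) = (x \in B).
Proof. by move=> ug; apply: mem_imset; apply: can_inj (mulmxK ug). Qed.

Lemma img_inj g : g \in unitmx -> injective (img g).
Proof. by move=> ug; apply: imset_inj; apply: can_inj (mulmxK ug). Qed.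

Definition periods (B : {set V}) : {set V} := [set c | shift B c == B].

Lemma periods0 B : 0 \in periods B. Proof. by rewrite inE shift0. Qed.

Lemma periods_sub (B : {set V}) : 0 \in B -> periods B \subset B.
Proof.
by move=> B0; apply/subsetP => c; rewrite inE => /eqP <-; rewrite mem_shift subrr.
Qed.

Lemma periods_shift B c : periods (shift B c) = periods B.
Proof.
have inj : injective (shift^~ c).
  by apply: can_inj (shift^~ (- c)) _ => A; rewrite shiftD addrN shift0.
by apply/setP => d; rewrite !inE shiftD addrC -shiftD (inj_eq inj).
Qed.

Lemma img_periods g B : g \in unitmx -> periods (img g B) = img g (periods B).
Proof.
move=> ug; apply/setP => x; rewrite -[x](mulmxKV ug) (mem_img _ _ ug) !inE -img_shift.
by rewrite (inj_eq (img_inj ug)).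
Qed.

Section Design.
Implicit Types B C X : {set V}.
Variables (gT : finGroupType) (mat : gT -> 'M['F_3]_4).
Hypotheses (matM : forall x y, mat (x * y)%g = mat x *m mat y) (mat1 : mat 1%g = 1%:M)
  (mat_inj : injective mat).
Variables (D : {set {set V}}) (G : {group gT}).
Hypotheses (design_D : is_2design (3 ^ 4) (3 ^ 2) 3 D)
  (shift_D : forall B c, B \in D -> shift B c \in D)
  (img_D : forall B g, B \in D -> g \in G -> img (mat g) B \in D)
  (trans_D : forall B C, B \in D -> C \in D -> 0 \in B -> 0 \in C ->
     exists2 g, g \in G & img (mat g) B = C).

Let S := [set B in D | 0 \in B].
Let mat_unit x : mat x \in unitmx := mat_unit matM mat1 x.

Lemma card_S_block B : B \in S -> #|B| = 9%N.
Proof. by case: design_D => _ H _; rewrite inE => /andP[/H]. Qed.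

Lemma card_S_point x : x != 0 -> #|[set B in S | x \in B]| = 3%N.
Proof.
case: design_D => _ _ H /H E; apply: etrans E; apply: eq_card => B.
by rewrite !inE -andbA (andbC (0 \in B)).
Qed.

Lemma img_S B g : g \in G -> (img (mat g) B \in S) = (B \in S).
Proof.
have key C h : h \in G -> C \in S -> img (mat h) C \in S.
  move=> Gh; rewrite !inE => /andP[DC C0]; rewrite img_D //=.
  by rewrite -(mul0mx _ (mat h)) mem_img.
move=> Gg; apply/idP/idP => [H|]; last exact: key.
have := key _ g^-1%g (groupVr Gg) H.
by rewrite -imgM -matM mulgV mat1 img1.
Qed.

Lemma card_S : #|S| = 30%N.
Proof.
have := double_count S (fun B => B :\ 0).
rewrite (eq_bigr (fun _ => 8%N)) => [|B SB]; last first.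
  have := card_S_block SB; rewrite (cardsD1 (0 : V)).
  by move: SB; rewrite inE => /andP[_ ->]; rewrite add1n => -[].
rewrite sum_nat_const (bigD1 (0 : V)) //=.
have -> : #|[set B in S | (0 : V) \in B :\ 0]| = 0%N.
  by apply: eq_card0 => B; rewrite inE setD11 andbF.
rewrite (eq_bigr (fun _ => 3%N)) => [|x nx]; last first.
  by apply: etrans (card_S_point nx); apply: eq_card => B; rewrite !inE nx.
rewrite sum_nat_const add0n => E; apply/eqP; rewrite -(eqn_pmul2r (isT : (0 < 8)%N)) E.
have := cardC1 (0 : V); rewrite (_ : #|predC1 (0 : V)| = #|(fun x : V => x != 0)|) //.
by move=> ->; case: design_D => -> _ _.
Qed.

Lemma trans_S B C : B \in S -> C \in S -> exists2 g, g \in G & img (mat g) B = C.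
Proof. by rewrite !inE => /andP[DB B0] /andP[DC C0]; apply: trans_D. Qed.

Lemma card_periods_const B C : B \in S -> C \in S -> #|periods B| = #|periods C|.
Proof.
move=> SB SC; have [g _ <-] := trans_S SB SC.
by rewrite img_periods // card_imset //; apply: can_inj (mulmxK (mat_unit g)).
Qed.

(** The translates of [B] that pass through 0. Two points of [B] give the same translate exactly
    when they differ by a period, so the class has 9 divided by the number of periods as its
    size. *)
Let class (B : {set V}) := [set shift B (- b) | b in B].

Lemma classP B C : reflect (exists2 b, b \in B & C = shift B (- b)) (C \in class B).
Proof. exact: imsetP. Qed.

Lemma card_class B : B \in S -> (#|class B| * #|periods B|)%N = 9%N.
Proof.
move=> SB; rewrite -(card_S_block SB); apply/esym/card_fibers => b Bb.
rewrite -(card_imset (mem (periods B)) (addrI b)).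
apply: eq_card => y; rewrite inE; apply/andP/imsetP.
  case=> By /eqP E; exists (y - b); last by rewrite addrC subrK.
  by rewrite inE addrC -shiftD -E shiftD addNr shift0.
case=> c; rewrite inE => /eqP cE ->; split; first by rewrite -cE mem_shift addrK.
by rewrite opprD -{1}cE shiftD addrCA addrN addr0.
Qed.

Lemma class_S B C : B \in S -> C \in class B -> C \in S.
Proof.
rewrite inE => /andP[DB _] /classP[b Bb ->].
by rewrite inE shift_D // mem_shift sub0r opprK.
Qed.

Lemma class_eq B C : B \in S -> C \in S -> (class C == class B) = (C \in class B).
Proof.
rewrite !inE => /andP[_ B0] /andP[_ C0]; apply/eqP/idP => [<-|/classP[b Bb ->]].
  by apply/classP; exists 0; rewrite // oppr0 shift0.
apply/setP => X; apply/classP/classP => -[x Hx ->].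
  by exists (x + b); [move: Hx; rewrite mem_shift opprK | rewrite shiftD opprD addrC].
by exists (x - b); [rewrite mem_shift opprK subrK | rewrite shiftD opprB addKr].
Qed.

(** Transitivity gives all blocks through 0 equally many periods, so the classes cut the 30 blocks
    into parts of equal size. *)
Lemma card_class_dvd B : B \in S -> (#|class B| %| 30)%N.
Proof.
move=> SB; rewrite -card_S (card_fibers (f := class) (A := S) (n := #|class B|)) ?dvdn_mull //.
move=> C SC; have -> : #|class B| = #|class C|.
  have pos : (0 < #|periods B|)%N by rewrite (cardsD1 (0 : V)) periods0.
  apply/eqP; rewrite -(eqn_pmul2r pos) card_class //.
  by rewrite (card_periods_const SB SC) card_class.
apply: eq_card => X; rewrite inE; apply/andP/idP => [[SX]|CX]; first by rewrite class_eq.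
by have SX := class_S SC CX; rewrite class_eq.
Qed.

(* With one period the 30 blocks through 0 would fall into translation classes of 9; with
   three periods each nonzero period of a block is one for its whole class of 3 blocks, so
   at most 30 * 2 / 3 = 20 vectors are periods. *)
Lemma periods_eq B :
    (forall U : {set V}, (forall x g, g \in G -> x \in U -> x *m mat g \in U) ->
       U != set0 -> 0 \notin U -> (20 < #|U|)%N) ->
  B \in S -> periods B = B.
Proof.
move=> large SB; have B0 : 0 \in B by move: SB; rewrite inE => /andP[].
apply/eqP; rewrite eqEcard periods_sub // (card_S_block SB) leqNgt; apply/negP => lt9.
have cE := card_class SB; have := card_class_dvd SB.
have [p3 c3] : #|periods B| = 3%N /\ #|class B| = 3%N.
  have c9 : (#|class B| <= 9)%N by rewrite dvdn_leq // -cE dvdn_mulr.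
  move: cE lt9 (card_class_dvd SB) c9; move: #|periods B| #|class B| => p c.
  by case: c => [|[|[|[|[|[|[|[|[|[|c]]]]]]]]]] // E lt9 _ _; try split; lia.
move=> _; pose U := [set u : V | (u != 0) && [exists C in S, u \in periods C]].
have := double_count S (fun C => periods C :\ 0).
rewrite (eq_bigr (fun _ => 2%N)) => [|C SC]; last first.
  have := card_periods_const SB SC; rewrite p3 (cardsD1 (0 : V) (periods C)) periods0 add1n.
  by case.
rewrite sum_nat_const card_S => E.
have : (\sum_(u in U) 3 <= 60)%N.
  rewrite (_ : 60%N = (30 * 2)%N) // E [leqRHS](bigID (mem U)) /= (leq_trans _ (leq_addr _ _)) //.
  apply: leq_sum => u; rewrite inE => /andP[nu /existsP[C /andP[SC uC]]].
  have c3C : #|class C| = 3%N.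
    by have := card_class SC; rewrite -(card_periods_const SB SC) p3; lia.
  apply: leq_trans (_ : #|class C| <= _)%N; first by rewrite c3C.
  apply: subset_leq_card; apply/subsetP => X CX; rewrite inE (class_S SC CX) in_setD1 nu /=.
  by have /classP[b _ ->] := CX; rewrite periods_shift.
rewrite sum_nat_const leqNgt => /negP[]; rewrite (@ltn_pmul2r 3 20) //; apply: large.
- move=> x g Gg; rewrite !inE => /andP[nx /existsP[C /andP[SC xC]]].
  apply/andP; split; first by apply: contraNneq nx => x0; rewrite -(mulmxK (mat_unit g) x) x0 mul0mx.
  by apply/existsP; exists (img (mat g) C); rewrite img_S // SC img_periods // mem_img.
- have : (0 < #|periods B :\ (0%R : V)|)%N.
    by move: p3; rewrite (cardsD1 (0 : V)) periods0 add1n => -[->].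
  case/card_gt0P => u /setD1P[nu Pu]; apply/set0Pn; exists u.
  by rewrite inE nu; apply/existsP; exists B; rewrite SB.
- by rewrite inE eqxx.
Qed.
End Design.

(** * The design D3 *)

(** The two lists of planes do not depend on [h]; binding them outside the quantifier lets them be
    computed once. *)
Lemma check_order3 : let s b := [seq l <- lines | stabilised l == b] in
  let sT := s true in let sF := s false in
  all (fun h => [&& check_vectors h, check_lines h true sT & check_lines h false sF]) order3.
Proof. by vm_compute. Qed.

Lemma lset_gens M l : dec M l.1 \in lset M l /\ dec M l.2 \in lset M l.
Proof.
by split; apply/lsetP; [exists 1, 0 | exists 0, 1]; rewrite scale1r scale0r ?addr0 ?add0r.
Qed.

Lemma lset_imgE M l : lset M l = img M (lset 1%:M l).
Proof.
have decM u : dec M u = dec 1%:M u *m M by rewrite /dec mulmx1.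
apply/setP => x; apply/lsetP/imsetP => [[a [b ->]]|[_ /lsetP[a [b ->]] ->]].
  exists (a *: dec 1%:M l.1 + b *: dec 1%:M l.2); first by apply/lsetP; exists a, b.
  by rewrite mulmxDl -!scalemxAl -!decM.
by exists a, b; rewrite mulmxDl -!scalemxAl -!decM.
Qed.

Section Action.
Variables (gT : finGroupType) (mat : gT -> 'M['F_3]_4).
Hypotheses (matM : forall x y, mat (x * y)%g = mat x *m mat y) (mat1 : mat 1%g = 1%:M).

Definition img_by (B : {set V}) (g : gT) := img (mat g) B.

Fact img_by1 : img_by^~ 1%g =1 id.
Proof. by move=> B; rewrite /img_by mat1 img1. Qed.

Fact img_by_morph B : act_morph img_by B.
Proof. by move=> g h; rewrite /img_by matM imgM. Qed.

Definition img_action := TotalAction img_by1 img_by_morph.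

Lemma orbit_img (G : {group gT}) (S : {set {set V}}) (B : {set V}) :
    B \in S -> (forall C g, C \in S -> g \in G -> img (mat g) C \in S) ->
    (forall C, C \in S -> exists2 g, g \in G & img (mat g) B = C) ->
  (#|S| %| #|G|)%N.
Proof.
move=> SB closed trans; suff -> : S = orbit img_action G B by apply: dvdn_orbit.
apply/setP => C; apply/idP/orbitP => [/trans[g Gg <-]|[g Gg <-]]; first by exists g.
exact: closed.
Qed.
End Action.

Section Base.
Variables (gT : finGroupType) (mat : gT -> 'M['F_3]_4).
Hypotheses (matM : forall x y, mat (x * y)%g = mat x *m mat y) (mat1 : mat 1%g = 1%:M).
Variables a b : gT.
Hypotheses (aE : mat a = alpha_mx) (bE : mat b = beta_mx).

Lemma base_lines_closed :
  all (fun l => (lact alpha4 l \in base_lines) && (lact beta4 l \in base_lines)) base_lines.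
Proof. by vm_compute. Qed.

Lemma base_lines_reach : base_lines = reach [:: lact alpha4; lact beta4] base4.
Proof. by vm_compute. Qed.

Lemma lset_base4 : lset 1%:M base4 = B0.
Proof.
have d1 : dec 1%:M base4.1 = delta_mx 0 0.
  by rewrite /dec mulmx1; apply/rowP; apply: ord4P; rewrite !mxE.
have d2 : dec 1%:M base4.2 = delta_mx 0 ord_max.
  by rewrite /dec mulmx1; apply/rowP; apply: ord4P; rewrite !mxE.
apply/setP => v; rewrite inE span_cons span_seq1.
apply/lsetP/memv_addP => [[i [j ->]]|[_ /vlineP[i ->] [_ /vlineP[j ->] ->]]].
  by rewrite d1 d2; do 2 (eexists; first by apply/vlineP; eexists).
by exists i, j; rewrite d1 d2.
Qed.

Lemma img_alpha l : img (mat a) (lset 1%:M l) = lset 1%:M (lact alpha4 l).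
Proof.
apply: img_lact; rewrite ?unitmx1 // mul1mx mulmx1 aE.
by apply/matrixP; apply: ord4P; apply: ord4P; rewrite !mxE.
Qed.

Lemma img_beta l : img (mat b) (lset 1%:M l) = lset 1%:M (lact beta4 l).
Proof.
apply: img_lact; rewrite ?unitmx1 // mul1mx mulmx1 bE.
by apply/matrixP; apply: ord4P; apply: ord4P; rewrite !mxE.
Qed.

Lemma base_linesE (B : {set V}) :
  reflect (exists2 A, A \in <<[set a; b]>>%g & B = img (mat A) B0)
          (B \in map (lset 1%:M) base_lines).
Proof.
apply: (iffP mapP) => [[l bl ->]|[A]].
  have ma : a \in <<[set a; b]>>%g by rewrite mem_gen // !inE eqxx.
  have mb : b \in <<[set a; b]>>%g by rewrite mem_gen // !inE eqxx orbT.
  (* Lying in the orbit of [B0] is preserved in both directions by the generators, hence constant on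
     the list computed from [base4]. *)
  pose Q l := [exists A in <<[set a; b]>>%g, lset 1%:M l == img (mat A) B0].
  have Qgen c l' l'' : c \in <<[set a; b]>>%g -> img (mat c) (lset 1%:M l') = lset 1%:M l'' ->
      Q l'' = Q l'.
    move=> Hc E; apply/existsP/existsP => -[A /andP[HA /eqP EA]].
      exists (A * c^-1)%g; rewrite groupM ?groupV //= matM imgM -EA -E -imgM -matM mulgV.
      by rewrite mat1 img1.
    by exists (A * c)%g; rewrite groupM //= matM imgM -EA E.
  have : Q l.
    rewrite (reach_invariant (a1 := lact alpha4) (a2 := lact beta4) (Q := Q) _ _ (x := base4)).
    - by apply/existsP; exists 1%g; rewrite group1 mat1 img1 lset_base4 /=.
    - by move=> x; apply: (Qgen a) => //; apply: img_alpha.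
    - by move=> x; apply: (Qgen b) => //; apply: img_beta.
    by rewrite -base_lines_reach.
  by case/existsP=> A /andP[HA /eqP ->]; exists A.
case/gen_prodgP=> n [c Hc ->] {A} ->.
elim: n c Hc => [|n IH] c Hc.
  exists base4; first by rewrite base_lines_reach reach_self.
  by rewrite big_ord0 mat1 img1 lset_base4.
rewrite big_ord_recr /= matM imgM.
have [l bl ->] := IH (fun i => c (widen_ord (leqnSn n) i)) (fun i => Hc _).
have /andP[la lb] := allP base_lines_closed l bl.
have := Hc ord_max; rewrite !inE => /orP[] /eqP ->.
  by exists (lact alpha4 l); rewrite // img_alpha.
by exists (lact beta4 l); rewrite // img_beta.
Qed.
End Base.

(** * Identification of the blocks *)

Lemma toD3_unit b : toM (toD3 b) \in unitmx.
Proof.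
pose inverse : m4 := if b
  then ((p3, z3, z3, z3), (p3, n3, n3, z3), (z3, z3, n3, z3), (p3, z3, n3, n3))
  else ((z3, p3, n3, p3), (n3, z3, z3, z3), (z3, p3, z3, n3), (n3, z3, n3, p3)).
have E : mmul (toD3 b) inverse = mone by case: b @inverse; vm_compute.
have U : toM (toD3 b) *m toM inverse = 1%:M by rewrite -toM_mul E toM1.
exact: (proj1 (mulmx1_unit U)).
Qed.

Section Main.
Variables (gT : finGroupType) (mat : gT -> 'M['F_3]_4).
Hypotheses (matM : forall x y, mat (x * y)%g = mat x *m mat y) (mat1 : mat 1%g = 1%:M)
  (mat_inj : injective mat).
Variables (D : {set {set V}}) (G R : {group gT}).
Hypotheses (design_D : is_2design (3 ^ 4) (3 ^ 2) 3 D)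
  (shift_D : forall B c, B \in D -> shift B c \in D)
  (img_D : forall B g, B \in D -> g \in G -> img (mat g) B \in D)
  (trans_D : forall B C, B \in D -> C \in D -> 0 \in B -> 0 \in C ->
     exists2 g, g \in G & img (mat g) B = C).
Hypotheses (hR : (R \isog 'D^1*Q)%g) (nRG : (G \subset 'N(R))%g).

Let S := [set B in D | 0 \in B].
Let mat_unit x : mat x \in unitmx := mat_unit matM mat1 x.
Let imgS := img_S matM mat1 img_D.

Lemma dvd30 : (30 %| #|G|)%N.
Proof.
have cS : #|S| = 30%N := card_S design_D.
have /card_gt0P[B SB] : (0 < #|S|)%N by rewrite cS.
rewrite -cS; apply: (orbit_img matM mat1 SB).
  by move=> C g SC Gg; rewrite imgS.
by move=> C SC; apply: trans_S trans_D _ _ SB SC.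
Qed.

(** Invariance under [G] together with transitivity makes this a single bit for all blocks through
    0; its coordinate form is [stabilised]. *)
Definition has_stabiliser z (B : {set V}) :=
  [exists y in R, involution z y && (img (mat y) B == B)].

Lemma has_stabiliser_img z B g : mat z = - 1%:M -> g \in G -> has_stabiliser z B ->
  has_stabiliser z (img (mat g) B).
Proof.
move=> zE Gg /existsP[y /andP[Ry /andP[Iy /eqP yB]]]; apply/existsP; exists (y ^ g)%g.
rewrite memJ_norm ?(subsetP nRG) // Ry /= (involutionJ matM mat_inj zE) Iy /=.
by rewrite -imgM -matM -conjgC matM imgM yB.
Qed.

Section Coordinates.
Variables (M : 'M['F_3]_4) (z f h : gT) (c : m4).
Hypotheses (uM : M \in unitmx) (zE : mat z = - 1%:M) (Gf : f \in G) (Gh : h \in G)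
  (Ef : crel mat M f f0) (Eh : crel mat M h c) (c3 : c \in order3).
Hypotheses
  (RC : {in R, forall y, involution z y -> exists2 c, c \in signed_clifford & crel mat M y c})
  (CR : {in signed_clifford, forall c,
           exists2 y, y \in R & involution z y /\ crel mat M y c}).

Lemma large_invariant (U : {set V}) :
    (forall x g, g \in G -> x \in U -> x *m mat g \in U) -> U != set0 -> 0 \notin U ->
  (20 < #|U|)%N.
Proof.
move=> closed /set0Pn[u Uu] U0; have [p Eu] := dec_onto uM u; rewrite Eu in Uu.
pose Q q := dec M q \in U.
have Qgen g m q : g \in G -> crel mat M g m -> Q (vmul q m) = Q q.
  move=> Gg E; rewrite /Q (dec_mul _ E); apply/idP/idP => [H|]; last exact: closed.
  by have := closed _ _ (groupVr Gg) H; rewrite -mulmxA -matM mulgV mat1 mulmx1.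
have /and3P[/andP[/eqP sz large] _ _] := allP check_order3 c c3.
have Q1 q : Q (vmul q f0) = Q q by apply: Qgen Ef.
have Q2 q : Q (vmul q c) = Q q by apply: Qgen Eh.
have [_ sub] := orbits_sub (vmul^~ f0) (vmul^~ c) [::] nonzero_vectors.
have hom := @orbits_homogeneous _ (vmul^~ f0) (vmul^~ c) Q Q1 Q2 [::] nonzero_vectors.
set os := orbits _ _ _ in sz large sub hom.
(* The lists cover the 80 nonzero vectors with 80 entries in total, so nothing is repeated and the
   length of a list counts distinct vectors. *)
have uos : uniq (flatten os).
  by apply: leq_size_uniq sub _; rewrite ?sz //; apply: (@uniq_behead _ _ uniq_vectors).
have /sub/flattenP[o oos po] : p \in nonzero_vectors.
  by rewrite mem_nonzero; apply: contraNneq U0 => p0; rewrite -(dec0 M) -p0.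
have uo : uniq o.
  move: (os) oos uos => s so; case/splitPr: so => s1 s2.
  by rewrite flatten_cat cat_uniq /= cat_uniq => /and3P[_ _ /andP[]].
have [//|d od] := hom _ o oos.
have Qo q : q \in o -> Q q by move=> /od ->; rewrite -(od p po).
have {}large : (20 < size o)%N := allP large o oos.
clearbody os; apply: (leq_trans large).
have um : uniq (map (dec M) o) by rewrite (map_inj_uniq (dec_inj uM)).
rewrite -(size_map (dec M)) -(card_uniqP um).
by apply: subset_leq_card; apply/subsetP => _ /mapP[q /Qo qo ->].
Qed.

Lemma S_line B : B \in S -> exists2 l, l \in lines & B = lset M l.
Proof.
move=> SB; have pB := periods_eq matM mat1 design_D shift_D img_D trans_D large_invariant SB.
apply: subspace_lset => //; first exact: (card_S_block design_D SB).
  by move: SB; rewrite inE => /andP[].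
by move=> x y Bx; rewrite -{1}pB inE => /eqP <-; rewrite mem_shift addrK.
Qed.

Lemma has_stabiliser_lset l : l \in lines -> has_stabiliser z (lset M l) = stabilised l.
Proof.
move=> ll; apply/existsP/hasP.
  case=> y /andP[Ry /andP[Iy /eqP yl]]; have [a Ca Ea] := RC Ry Iy; exists a => //.
  have [] := lset_gens M (vmul l.1 a, vmul l.2 a).
  by rewrite -(lset_img l Ea) yl !(in_lset uM) /= => -> ->.
case=> a Ca /andP[l1 l2]; have [y Ry [Iy Ea]] := CR Ca; exists y; rewrite Ry Iy /=.
rewrite eqEcard (lset_img l Ea) lset_sub ?(in_lset uM) //= -(lset_img l Ea).
by rewrite card_imset //; apply: can_inj (mulmxK (mat_unit y)).
Qed.

Lemma S_standard : exists2 N, N \in unitmx &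
  [set img N B | B in S] = [set B in map (lset 1%:M) base_lines].
Proof.
have cS : #|S| = 30%N := card_S design_D.
have /card_gt0P[B1 SB1] : (0 < #|S|)%N by rewrite cS.
pose b := has_stabiliser z B1.
have Sb B : B \in S -> has_stabiliser z B = b.
  move=> SB; have [g Gg <-] := trans_S trans_D SB1 SB.
  apply/idP/idP; last exact: has_stabiliser_img.
  move=> /(has_stabiliser_img zE (groupVr Gg)); by rewrite -imgM -matM mulgV mat1 img1.
pose Q l := lset M l \in S.
have Q1 l : Q (lact f0 l) = Q l by rewrite /Q -(img_lact uM l Ef) imgS.
have Q2 l : Q (lact c l) = Q l by rewrite /Q -(img_lact uM l Eh) imgS.
pose s := [seq l <- lines | stabilised l == b].
have us : uniq s by apply: filter_uniq.
have ps : perm_eq (map (lset M) (filter Q s)) (enum S).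
  apply: uniq_perm; rewrite ?enum_uniq //.
    rewrite map_inj_in_uniq ?filter_uniq // => l l'; rewrite !mem_filter.
    by move=> /and3P[_ _ ll] /and3P[_ _ ll']; apply: (lset_lines_inj uM).
  move=> B; rewrite mem_enum; apply/mapP/idP => [[l]|SB].
    by rewrite mem_filter => /andP[Ql _] ->.
  have [l ll Bl] := S_line SB; exists l => //.
  by rewrite !mem_filter /Q -Bl SB ll -(has_stabiliser_lset ll) -Bl Sb //= eqxx.
have /and3P[_ chkT chkF] := allP check_order3 c c3.
have : check_lines c b s by rewrite /s; case: (b).
case/andP=> /eqP sz chk.
have [X uX pX] := orbits_solution Q1 Q2 us sz.
have pXS : perm_eq (map (lset M) X) (enum S) := perm_trans (perm_map _ pX) ps.
have sX : size X = 30%N by rewrite -(size_map (lset M)) (perm_size pXS) -cardE.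
have countS : count Q s = 30%N by rewrite -size_filter -(perm_size pX).
rewrite countS in uX.
have dX : design X.
  apply/allP => p np; have nz : dec M p != 0.
    by rewrite -(dec0 M) (inj_eq (dec_inj uM)) -mem_nonzero.
  apply/eqP; apply: etrans (card_S_point design_D nz).
  rewrite -(count_enum _ (fun B : {set V} => dec M p \in B)) -(seq.permP pXS) count_map.
  by apply/eq_count => l; rewrite /= (in_lset uM).
have /implyP := allP chk X uX; rewrite sX dX => /(_ isT)/allP toB.
(* The inverse of [M] passes from the Clifford basis to standard coordinates, where [toD3 b] carries
   the planes to those of [D3]. *)
pose N := invmx M *m toM (toD3 b).
have uN : N \in unitmx by rewrite unitmx_mul unitmx_inv uM toD3_unit.
exists N; first exact: uN.
have imN l : img N (lset M l) = lset 1%:M (lact (toD3 b) l).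
  rewrite (lset_imgE M) -imgM (mulKVmx uM).
  apply: img_lact; first exact: unitmx1.
  by rewrite mul1mx mulmx1.
(* One inclusion suffices: the left side has 30 members because [img N] is injective, and
   [base_lines] has at most 30. *)
apply/eqP; rewrite eqEcard; apply/andP; split.
  apply/subsetP => _ /imsetP[B SB ->]; rewrite inE.
  have /mapP[l Xl ->] : B \in map (lset M) X by rewrite (perm_mem pXS) mem_enum.
  by rewrite imN map_f ?toB.
rewrite card_imset ?cS; last exact: img_inj.
by rewrite cardsE (leq_trans (card_size _)) // size_map.
Qed.
End Coordinates.

Lemma blocks_standard : exists2 N, N \in unitmx &
  [set img N B | B in S] = [set B in map (lset 1%:M) base_lines].
Proof.
have d5 : (5 %| #|G|)%N := dvdn_trans (isT : 5 %| 30)%N dvd30.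
have d3 : (3 %| #|G|)%N := dvdn_trans (isT : 3 %| 30)%N dvd30.
have [f Gf of5] := Cauchy (isT : prime 5) d5.
have [h Gh oh3] := Cauchy (isT : prime 3) d3.
have [M [z [uM zE Ef RC CR]]] :=
  clifford_frame_order5 matM mat1 mat_inj hR (subsetP nRG f Gf) of5.
have [c Eh] := crel_exists mat uM h.
have c3 := order3_code matM mat1 mat_inj uM zE RC CR (subsetP nRG h Gh) oh3 Eh.
exact: (S_standard uM zE Gf Gh Ef Eh c3 RC CR).
Qed.
End Main.

(** * From permutations to matrices *)

Lemma translationE c (B : {set V}) : translation c @: B = shift B c.
Proof. by apply: eq_imset => x; rewrite permE. Qed.

Lemma linear_permE g (B : {set V}) : linear_perm g @: B = img (GLval g) B.
Proof. by apply: eq_imset => x; rewrite permE. Qed.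

Local Close Scope ring_scope.

Theorem theorem4p2
  (D : {set {set 'rV['F_3]_4}})
  (hD : is_2design (3 ^ 4) (3 ^ 2) 3 D)
  (G : {group {perm 'rV['F_3]_4}})
  (G0 R : {group {'GL_4(3)}})
  (hG : G :=: (translations * linear_perm @: G0)%g)
  (hR : (R \isog 'D^1*Q)%g)
  (hG0 : (G0 \subset 'N(R))%g)
  (hAut : G \subset design_aut D)
  (hflag : flag_transitive G D) :
  design_iso D D3.
Proof.
have linear_perm1 : linear_perm 1%g = 1%g.
  by apply/permP => x; rewrite permE perm1 /= mulmx1.
have translation0 : translation 0 = 1%g.
  by apply/permP => x; rewrite permE perm1 addr0.
have autD (p : {perm V}) (B : {set V}) : p \in G -> B \in D -> p @: B \in D.
  move=> /(subsetP hAut) Dp; rewrite -(astabs_act B Dp); exact.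
have shift_D (B : {set V}) c : B \in D -> shift B c \in D.
  move=> DB; rewrite -translationE autD // hG -[translation c]mulg1 -linear_perm1.
  by rewrite mem_mulg ?imset_f ?group1.
have img_D (B : {set V}) g : B \in D -> g \in G0 -> img (GLval g) B \in D.
  move=> DB Gg; rewrite -linear_permE autD // hG -[linear_perm g]mul1g -translation0.
  by rewrite mem_mulg ?imset_f.
have trans_D (B C : {set V}) : B \in D -> C \in D -> 0%R \in B -> 0%R \in C ->
    exists2 g, g \in G0 & img (GLval g) B = C.
  move=> DB DC B0 C0; have [p Gp [p0 pB]] := hflag 0%R 0%R B C DB B0 DC C0.
  move: Gp; rewrite hG => /mulsgP[_ _ /imsetP[c _ ->] /imsetP[g Gg ->] pE].
  exists g => //; rewrite -pB pE.
  have c0 : c = 0%R.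
    move: p0; rewrite pE permM !permE add0r /= => /(congr1 (mulmx^~ (invmx (GLval g)))).
    by rewrite mulmxK ?GL_unitmx // mul0mx.
  by rewrite c0 translation0 mul1g linear_permE.
have GLM (x y : {'GL_4(3)}) : GLval (x * y)%g = (GLval x *m GLval y)%R by [].
have GLinj : injective (@GLval 4 'F_3) := val_inj.
have [N uN SE] := blocks_standard GLM (erefl _) GLinj hD shift_D img_D trans_D hR hG0.
have D3P (B : {set V}) : B \in D3 ->
    exists l c, l \in map (lset 1%:M%R) base_lines /\ B = shift l c.
  case/imset2P=> A c HA _ ->; exists (img (GLval A) B0), c; split.
    by apply/(base_linesE GLM (erefl _) (a := alpha) (b := beta)) => //; exists A.
  by rewrite /shift /img -imset_comp; apply: eq_imset => v.
exists (mulmx^~ N); first by exists (mulmx^~ (invmx N)) => x; rewrite ?mulmxK ?mulmxKV.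
apply/setP => B; apply/imsetP/idP => [[C DC ->]|].
  (* A block becomes one through 0 after translation by [- b] for any of its points [b]; under [N]
     the translation back by [b] becomes translation by [b *m N]. *)
  have /card_gt0P[b Cb] : 0 < #|C| by case: hD => _ -> .
  have : img N (shift C (- b)%R) \in [set img N B | B in [set B in D | 0%R \in B]].
    by rewrite imset_f // inE shift_D // mem_shift sub0r opprK.
  rewrite SE inE => /(base_linesE GLM (erefl _) (a := alpha) (b := beta))[//|//|A HA E].
  apply/imset2P; exists A (b *m N)%R => //; rewrite -/(img N C).
  have -> : C = shift (shift C (- b)%R) b by rewrite shiftD addNr shift0.
  by rewrite img_shift E /shift /img -imset_comp; apply: eq_imset => v.
case/D3P=> l [c [ll ->]].
have : l \in [set img N B | B in [set B in D | 0%R \in B]] by rewrite SE inE.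
case/imsetP=> C; rewrite inE => /andP[DC _] ->; exists (shift C (c *m invmx N)%R).
  exact: shift_D.
by rewrite -/(img N _) img_shift mulmxKV.
Qed.
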